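(* Let $\mathcal{P}$ be an $n$-dimensional convex polytope in $\mathbb{R}^n$ and let $\mathbf{s}\in\mathbb{R}^n$, $\mathbf{s}\neq\mathbf{0}$. For $\lambda>0$ let $$\varphi_{\mathcal{P},\mathbf{s}}(\lambda)=\int_{\mathcal{P}} e^{-i\frac{1}{\lambda}\mathbf{s}\cdot\mathbf{x}}\,d\mathbf{x}.$$ Then, as $\lambda\to 0^+$, $$\varphi_{\mathcal{P},\mathbf{s}}(\lambda)=\frac{i}{\|\mathbf{s}\|}\left(\sum_{F\in\mathcal{F}_{\mathcal{P}}:\ \mathbf{s}\perp F}\operatorname{sgn}_{\mathcal{P}}(F,\mathbf{s})\, A_F\, e^{-i\frac{1}{\lambda}\mathbf{s}\cdot\mathbf{p}_F}\right)\lambda+O(\lambda^2),$$ where the sum is empty (equal to $0$) if $\mathbf{s}$ is orthogonal to no facet of $\mathcal{P}$.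
   Context: $\mathbf{s}\cdot\mathbf{x}$ is the standard scalar product on $\mathbb{R}^n$ and $\|\cdot\|$ the Euclidean norm. $\mathcal{F}_{\mathcal{P}}$ is the set of facets ($(n-1)$-dimensional faces) of $\mathcal{P}$. For a facet $F$, $\mathbf{s}\perp F$ means $\mathbf{s}$ is orthogonal to $F$ (i.e. to the hyperplane containing $F$); $A_F>0$ is the $(n-1)$-dimensional surface measure of $F$; $\mathbf{p}_F$ is an arbitrary point of the affine hyperplane containing $F$ (when $\mathbf{s}\perp F$ the value $\mathbf{s}\cdot\mathbf{p}_F$ does not depend on this choice). For $\mathbf{s}\perp F$, $\operatorname{sgn}_{\mathcal{P}}(F,\mathbf{s})=1$ if $\mathbf{s}$ is directed to the outside of $\mathcal{P}$ (i.e. is a positive multiple of the outward normal of $F$) and $-1$ otherwise. *)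

(* Defs.v *)
From HB Require Import structures.
From mathcomp Require Import all_boot all_order all_algebra.
From mathcomp Require Import all_classical all_reals all_analysis.
From mathcomp Require Import complex.
Set Implicit Arguments. Unset Strict Implicit. Unset Printing Implicit Defensive.
Import Order.TTheory GRing.Theory Num.Theory.
Local Open Scope classical_set_scope.
Local Open Scope ring_scope.

Section Defs.
Variable R : realType.

Definition dotv n (x y : 'rV[R]_n) : R := \sum_(i < n) x ord0 i * y ord0 i.
Definition normv n (x : 'rV[R]_n) : R := Num.sqrt (dotv x x).

(* Lebesgue integral over R^n, written out as the iterated one-dimensional
   Lebesgue integrals (Fubini); R^0 is a point (integral = evaluation). *)
Fixpoint iint (n : nat) : ('rV[R]_n -> R) -> R :=
  match n with
  | 0 => fun f => f 0
  | m.+1 => fun f : 'rV[R]_m.+1 -> R => Rintegral (@lebesgue_measure R) setT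
                  (fun t : R => iint (fun y : 'rV[R]_m =>
                     f (row_mx (const_mx t : 'rV[R]_1) y)))
  end.

Definition vol n (A : set 'rV[R]_n) : R := iint (fun x => \1_A x).

Definition convex_polytope n (P : set 'rV[R]_n) : Prop :=
  (exists (k : nat) (V : 'I_k -> 'rV[R]_n),
     P = [set x | exists w : 'I_k -> R, (forall j, 0 <= w j) /\
                   \sum_(j < k) w j = 1 /\ x = \sum_(j < k) w j *: V j]) /\
  (exists (c : 'rV[R]_n) (r : R), 0 < r /\
     forall x, normv (x - c) < r -> P x).

Definition face n (P F : set 'rV[R]_n) : Prop :=
  exists (a : 'rV[R]_n) (b : R), a != 0 /\
    (forall x, P x -> dotv a x <= b) /\
    F = P `&` [set x | dotv a x = b] /\ F !=set0.

(* facet: a face of dimension n-1, i.e. containing n affinely independent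
   points p, p + B_1, ..., p + B_(n-1) *)
Definition facet n (P F : set 'rV[R]_n) : Prop :=
  face P F /\
  exists (p : 'rV[R]_n) (B : 'M[R]_(n.-1, n)),
    F p /\ row_free B /\ forall i, F (p + row i B).

Definition orth n (s : 'rV[R]_n) (F : set 'rV[R]_n) : Prop :=
  forall x y, F x -> F y -> dotv s (x - y) = 0.

Definition outward_unit_normal n (P F : set 'rV[R]_n) (nu : 'rV[R]_n) : Prop :=
  normv nu = 1 /\ orth nu F /\
  forall x y, F x -> P y -> dotv nu y <= dotv nu x.

Definition sgnP n (P F : set 'rV[R]_n) (s : 'rV[R]_n) : R :=
  if `[< exists nu t, outward_unit_normal P F nu /\ 0 < t /\ s = t *: nu >]
  then 1 else -1.

Definition ptF n (F : set 'rV[R]_n) : 'rV[R]_n := xget 0 F.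

(* (n-1)-dimensional surface measure of a facet F: the (n-1)-dimensional
   Lebesgue measure of F read in an isometric parametrization
   y |-> p_F + y *m B (B with orthonormal rows) of the hyperplane containing F *)
Definition facet_area n (F : set 'rV[R]_n) : R :=
  let p := ptF F in
  let B := xget (0 : 'M[R]_(n.-1, n))
             [set B : 'M[R]_(n.-1, n) | B *m B^T = 1%:M /\
                forall x, F x -> exists y : 'rV[R]_(n.-1), x = p + y *m B] in
  vol [set y : 'rV[R]_(n.-1) | F (p + y *m B)].

Definition expi (theta : R) : R[i] := Complex (cos theta) (sin theta).

Definition phiPs n (P : set 'rV[R]_n) (s : 'rV[R]_n) (l : R) : R[i] :=
  Complex (iint (fun x => \1_P x * cos (- (l^-1 * dotv s x))))
          (iint (fun x => \1_P x * sin (- (l^-1 * dotv s x)))).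

Definition lead_coef_phi n (P : set 'rV[R]_n) (s : 'rV[R]_n) (l : R) : R[i] :=
  (Complex 0 1) * (real_complex R (normv s)^-1) *
  \sum_(F \in [set F | facet P F /\ orth s F])
     (real_complex R (sgnP P F s * facet_area F) *
      expi (- (l^-1 * dotv s (ptF F)))).

End Defs.

(* Main.v *)
Require Import Defs.
From HB Require Import structures.
From mathcomp Require Import all_boot all_order all_algebra.
From mathcomp Require Import all_classical all_reals all_analysis.
From mathcomp Require Import complex.
From mathcomp Require Import measurable_realfun ring lra.
Set Implicit Arguments. Unset Strict Implicit. Unset Printing Implicit Defensive.
Import Order.TTheory GRing.Theory Num.Theory.
Import numFieldNormedType.Exports.
Local Open Scope classical_set_scope.
Local Open Scope ring_scope.

(* Choose orthonormal coordinates (t, y) with t along u = s / |s|. As P is a finite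
   intersection of half-spaces, its section over y is an interval [- g y, h y] with g and
   h minima of finitely many affine functions, so integrating exp (- i w t), w = |s| /
   lambda, along t first leaves (i / w) times the difference of the integrals over the
   projection K of P of exp (- i w h) and exp (i w g).
   Cut K into the convex pieces on which h is a single affine function. Where h attains
   its maximum b the phase is constant, and this contributes the measure of the section of
   P at height b times exp (- i w b). On the part h < b of each piece the phase is affine
   and not constant, and one integration along a coordinate axis bounds the contribution
   by O(1 / w). The same holds for g.
   The section at height b is either the facet of P with outward normal u, or lies in a
   hyperplane of R^(n-1) and has measure 0; the minimal height gives the facet with
   outward normal - u. Orthogonal invariance of the iterated integral shows that the
   measure of the section is the facet area, whatever the orthonormal basis used. *)

(** * One-dimensional Lebesgue integrals *)

(** The integral is an iteration of one-dimensional integrals, with no product measure on R^n behind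
    it. Fubini and the linear change of variables are therefore proved by induction on the
    dimension, for bounded Borel functions of bounded support ([nice]); Gaussian elimination reduces
    the change of variables to one-dimensional scalings and translations. What shapes the estimates
    is uniformity: one constant must serve all convex Borel sets in a fixed cube and all phase
    shifts, because the induction replaces a set by its sections and moves the term of the fixed
    coordinate into the shift. Convexity provides this: a section along an axis is an interval, and
    a cosine of frequency [w] integrates over any interval to at most 2 / |w|. Only cosines are
    estimated; the shifts 0 and - pi / 2 yield the real and imaginary parts. The half-spaces come
    from Fourier-Motzkin elimination on the cone over the vertices lifted to height 1. The
    oscillation bound itself, with [w] tending to infinity, shows that a convex body inside a
    hyperplane is null. *)

Lemma measurable_affine (R : realType) (c a : R) :
  measurable_fun [set: R] (fun x : R => c * x + a).
Proof. by apply: measurable_funD => //; exact: measurable_funM. Qed.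

(** By uniqueness of Lebesgue measure: [|c|] times the pushforward under the affine map agrees with
    it on half-open intervals. A negative [c] swaps the open and the closed end. *)
Lemma lebesgue_measure_affine (R : realType) (c a : R) (A : set R) :
  c != 0 -> measurable A ->
  lebesgue_measure ((fun x => c * x + a) @^-1` A) =
  ((`|c|^-1)%:E * lebesgue_measure A)%E.
Proof.
move=> c0 mA.
pose phi : measurableTypeR R -> measurableTypeR R := fun x => c * x + a.
have mphi : measurable_fun setT phi by exact: measurable_affine.
have c_ge0 : 0 <= `|c| by [].
pose mu : {measure set (measurableTypeR R) -> \bar R} := mscale (NngNum c_ge0)
             (pushforward (@lebesgue_measure R) phi).
have cn0 : `|c| != 0 by rewrite normr_eq0.
suff -> : lebesgue_measure A = mu mphi A.
  by rewrite /mu /mscale/= /pushforward/= muleA -EFinM mulVf// mul1e.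
apply: (lebesgue_measure_unique (mu := mu mphi)) => // X /ocitvP[->|[[x y] /= xy ->]].
  by rewrite !measure0.
rewrite /mu /mscale/= [X in (_ * X)%E](_ : _ = lebesgue_measure (phi @^-1` `]x, y]))//.
have [c_gt0|c_lt0|/eqP] := ltgtP 0 c; last by rewrite eq_sym (negbTE c0).
- have -> : phi @^-1` `]x, y] = `](x - a) / c, (y - a) / c]%classic.
    apply/seteqP; split => t /=; rewrite /phi !in_itv/=.
      by rewrite ltr_pdivrMr// ler_pdivlMr//; move=> /andP[? ?]; apply/andP; split; lra.
    by rewrite ltr_pdivrMr// ler_pdivlMr//; move=> /andP[? ?]; apply/andP; split; lra.
  rewrite !lebesgue_measure_itv/= !lte_fin ltr_pM2r ?invr_gt0// ltrD2r.
  case: ifPn => // _; last by rewrite mule0.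
  rewrite -!EFinB -EFinM; congr EFin; rewrite gtr0_norm//; field.
  by rewrite gt_eqF.
- have -> : phi @^-1` `]x, y] = `[(y - a) / c, (x - a) / c[%classic.
    apply/seteqP; split => t /=; rewrite /phi !in_itv/=.
      by rewrite ltr_ndivlMr// ler_ndivrMr//; move=> /andP[? ?]; apply/andP; split; lra.
    by rewrite ltr_ndivlMr// ler_ndivrMr//; move=> /andP[? ?]; apply/andP; split; lra.
  rewrite !lebesgue_measure_itv/= !lte_fin ltr_nM2r ?invr_lt0// ltrD2r.
  case: ifPn => // _; last by rewrite mule0.
  rewrite -!EFinB -EFinM; congr EFin; rewrite ltr0_norm//; field.
  by rewrite lt_eqF.
Qed.

Lemma ge0_integral_affine (R : realType) (c a : R) (f : R -> \bar R) :
  c != 0 -> measurable_fun setT f -> (forall x, (0 <= f x)%E) ->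
  (\int[@lebesgue_measure R]_x f (c * x + a)%R =
   (`|c|^-1)%:E * \int[@lebesgue_measure R]_x f x)%E.
Proof.
move=> c0 mf f0.
pose phi : measurableTypeR R -> measurableTypeR R := fun x => c * x + a.
have mphi : measurable_fun setT phi by exact: measurable_affine.
have c_ge0 : 0 <= `|c|^-1 by rewrite invr_ge0.
have := @ge0_integral_pushforward _ _ _ _ R phi mphi (@lebesgue_measure R) setT f
  measurableT mf (fun y _ => f0 y).
rewrite preimage_setT /= => <-.
rewrite -(ge0_integral_mscale (@lebesgue_measure R) measurableT (NngNum c_ge0))//.
apply: eq_measure_integral => A mA _.
exact: lebesgue_measure_affine.
Qed.


Lemma Rintegral_affine (R : realType) (c a : R) (f : R -> R) :
  c != 0 -> (@lebesgue_measure R).-integrable setT (EFin \o f) ->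
  \int[@lebesgue_measure R]_x f (c * x + a) =
  `|c|^-1 * \int[@lebesgue_measure R]_x f x.
Proof.
move=> c0 intf.
have mf : measurable_fun setT (EFin \o f) by exact: measurable_int intf.
have fp := integrable_pos_fin_num measurableT intf.
have fn := integrable_neg_fin_num measurableT intf.
rewrite /Rintegral.
have -> : (\int[@lebesgue_measure R]_x (f (c * x + a))%:E =
   (`|c|^-1)%:E * \int[@lebesgue_measure R]_x (f x)%:E)%E.
  rewrite integralE [in RHS]integralE.
  have E1 := @ge0_integral_affine R c a ((EFin \o f)^\+)%E c0
    (measurable_funepos mf) (fun x => funepos_ge0 _ _).
  have E2 := @ge0_integral_affine R c a ((EFin \o f)^\-)%E c0
    (measurable_funeneg mf) (fun x => funeneg_ge0 _ _).
  under [X in (X - _)%E = _]eq_integral do rewrite funeposE -[X in maxe X]/((EFin \o f) _) -funeposE.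
  under [X in (_ - X)%E = _]eq_integral do rewrite funenegE -[X in (- X)%E]/((EFin \o f) _) -funenegE.
  rewrite E1 E2.
  apply/esym; apply: muleBr => //; apply: fin_num_adde_defl; rewrite fin_numN; exact: fn.
by rewrite -[X in (_ * X)%E](fineK (integrable_fin_num measurableT intf)).
Qed.

(** One constant bounds both the values and the support, so that combining several bounds only takes
    a maximum. *)
Definition bounded_support1 (R : realType) (g : R -> R) : Prop :=
  exists K : R, forall t, `|g t| <= K /\ (g t != 0 -> `|t| <= K).

Lemma bounded_support1_integrable (R : realType) (g : R -> R) :
  measurable_fun setT g -> bounded_support1 g ->
  (@lebesgue_measure R).-integrable setT (EFin \o g).
Proof.
move=> mg [K gK].
have gE : EFin \o g = (EFin \o g) \_ `[-K, K].
  apply/funext => t; rewrite patchE; case: ifPn => // /negP tK.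
  have [//|/= /eqP g0] := pselect (g t = 0); first by move=> /= ->.
  exfalso; apply: tK; rewrite inE/= in_itv/= -ler_norml.
  by have [_] := gK t; apply.
have mK : (lebesgue_measure (`[(- K)%R, K]%classic : set R) < +oo)%E.
  by rewrite lebesgue_measure_itv/=; case: ifP => // _; rewrite -EFinD ltry.
rewrite gE; apply: (integrable_mkcond _ _).1 => //.
apply: (@measurable_bounded_integrable _ _ _ (@lebesgue_measure R) g `[- K, K]%classic) => //.
- exact: measurable_funTS.
- exists K; split; first exact: num_real.
  move=> M KM t _ /=; apply: le_trans (ltW KM); exact: (gK t).1.
Qed.

(** Here values and support have separate constants: in the oscillation estimates [M] stays fixed
    while [C] carries the decay in [w]. *)
Lemma Rintegral_bound (R : realType) (g : R -> R) (C M : R) :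
  measurable_fun setT g -> 0 <= M ->
  (forall t, `|g t| <= C /\ (g t != 0 -> `|t| <= M)) ->
  `|\int[@lebesgue_measure R]_x g x| <= 2 * M * C.
Proof.
move=> mg M0 gC.
have C0 : 0 <= C by apply: le_trans (gC 0).1.
have bg : bounded_support1 g.
  exists (Num.max C M) => t; split; first by rewrite le_max (gC t).1.
  by move=> /(gC t).2 tM; rewrite le_max tM orbT.
have ig := bounded_support1_integrable mg bg.
apply: le_trans (le_normr_Rintegral _ ig) _ => //.
have bc : bounded_support1 (fun t => C * \1_(`[- M, M]%classic : set R) t).
  exists (Num.max C M) => t; rewrite indicE; case: (boolP (t \in _)) => tM; rewrite ?mulr1 ?mulr0.
    split; first by rewrite ger0_norm// le_max lexx.
    by move=> _; rewrite le_max; move: tM; rewrite inE/= in_itv/= -ler_norml => ->; rewrite orbT.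
  by rewrite normr0 le_max C0; split => //; rewrite eqxx.
have mc : measurable_fun setT (fun t : R => C * \1_(`[- M, M]%classic : set R) t).
  by apply: measurable_funM => //; exact: measurable_indic.
have ic := bounded_support1_integrable mc bc.
apply: (@le_trans _ _ (\int[@lebesgue_measure R]_t (C * \1_(`[- M, M]%classic : set R) t))).
  apply: le_Rintegral => //; first exact: integrable_norm.
  move=> t _; rewrite indicE; case: (boolP (t \in _)) => tM; rewrite ?mulr1 ?mulr0.
    exact: (gC t).1.
  case: (eqVneq (g t) 0) => [->|/(gC t).2]; first by rewrite normr0.
  by rewrite ler_norml => tM'; move: tM; rewrite notin_setE/= in_itv/= tM'.
rewrite RintegralZl//; last first.
  exact: integrable_indic_itv.
rewrite mulrC ler_wpM2r// /Rintegral integral_indic//= setIT lebesgue_measure_itv/=.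
by case: ifPn => _ //=; [lra|lra].
Qed.

Lemma measurable_Rintegral_param d (T : measurableType d) (R : realType)
    (g : T * R -> R) : measurable_fun setT g ->
  measurable_fun setT (fun t => \int[@lebesgue_measure R]_u g (t, u)).
Proof.
move=> mg; have mg' : measurable_fun setT (EFin \o g) by exact/measurable_EFinP.
rewrite /Rintegral; apply: measurableT_comp => //.
under eq_fun do rewrite integralE.
apply: emeasurable_funB.
- have := measurable_fun_fubini_tonelli_F (m2 := @lebesgue_measure R)
    (EFin \o g)^\+%E (measurable_funepos mg') (fun x => funepos_ge0 _ _).
  congr measurable_fun; apply/funext => t; apply: eq_integral => u _.
  by rewrite !funeposE.
- have := measurable_fun_fubini_tonelli_F (m2 := @lebesgue_measure R)
    (EFin \o g)^\-%E (measurable_funeneg mg') (fun x => funeneg_ge0 _ _).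
  congr measurable_fun; apply/funext => t; apply: eq_integral => u _.
  by rewrite !funenegE.
Qed.

Lemma Rintegral_swap (R : realType) (g : R * R -> R) (K : R) :
  measurable_fun setT g ->
  (forall p, `|g p| <= K /\ (g p != 0 -> `|p.1| <= K /\ `|p.2| <= K)) ->
  \int[@lebesgue_measure R]_t \int[@lebesgue_measure R]_u g (t, u) =
  \int[@lebesgue_measure R]_u \int[@lebesgue_measure R]_t g (t, u).
Proof.
move=> mg gK.
have K0 : 0 <= K by apply: le_trans (gK (0, 0)).1.
have mg' : measurable_fun setT (EFin \o g) by exact/measurable_EFinP.
have i1 t : (@lebesgue_measure R).-integrable setT (EFin \o (fun u => g (t, u))).
  apply: bounded_support1_integrable; first exact: measurableT_comp.
  by exists K => u; have [? gp] := gK (t, u); split => // /gp[].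
have i2 u : (@lebesgue_measure R).-integrable setT (EFin \o (fun t => g (t, u))).
  apply: bounded_support1_integrable; first exact: measurableT_comp.
  by exists K => t; have [? gp] := gK (t, u); split => // /gp[].
have ig : ((@lebesgue_measure R) \x (@lebesgue_measure R))%E.-integrable setT (EFin \o g).
  have mng : measurable_fun setT (fun p => `|g p|) by exact: measurableT_comp.
  have ing t : (@lebesgue_measure R).-integrable setT (EFin \o (fun u => `|g (t, u)|)).
    exact: (integrable_norm (i1 t)).
  (* Tonelli criterion: the inner integral of [|g|] is at most [2 * K * K] and vanishes for
     [|t| > K], so the iterated integral of [|g|] is finite. *)
  apply: (integrable12ltyP (@lebesgue_measure R) (@lebesgue_measure R) mg').2.
  under eq_integral => t _.
    rewrite (_ : (\int[_]_y _)%E = (\int[@lebesgue_measure R]_u `|g (t, u)|)%:E); last first.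
      by rewrite /Rintegral fineK//; exact: integrable_fin_num (ing t).
    over.
  apply: integrable_lty => //.
  apply: bounded_support1_integrable; first exact: (measurable_Rintegral_param mng).
  exists (Num.max K (2 * K * K)) => t; split.
    rewrite le_max; apply/orP; right; apply: Rintegral_bound => //.
      by apply: (measurableT_comp mng); exact: pair1_measurable.
    by move=> u; rewrite normr_id normr_eq0; have [? gp] := gK (t, u); split => // /gp[].
  rewrite le_max => ne0; apply/orP; left; apply: contraNT ne0 => tK.
  rewrite (_ : (fun u => _) = cst 0) ?Rintegral_cst ?mul0r//.
  apply/funext => u /=; apply/eqP; rewrite normr_eq0; apply: contraNT tK.
  by move=> /(gK (t, u)).2[].
rewrite /Rintegral; congr fine.
under eq_integral do rewrite fineK ?(integrable_fin_num _ (i1 _))//.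
under [RHS]eq_integral do rewrite fineK ?(integrable_fin_num _ (i2 _))//.
exact: (Fubini ig).
Qed.

(** * Oscillatory integrals over intervals *)

Lemma integral_cos_affine (R : realType) (w p l h : R) : w != 0 -> l <= h ->
  \int[@lebesgue_measure R]_(x in `[l, h]) cos (w * x + p) =
  w^-1 * (sin (w * h + p) - sin (w * l + p)).
Proof.
move=> w0; rewrite le_eqVlt => /predU1P[->|lh].
  by rewrite subrr mulr0 set_itv1 Rintegral_set1.
pose A : R -> R := fun x => w * x + p.
have dA x : is_derive (x : R) (1 : R) A w.
  rewrite /A; apply: is_derive_eq; rewrite addr0 -[RHS]mulr1; congr (_ * _).
pose F : R -> R := fun x => w^-1 * (sin \o A) x.
have dsA x : derivable (sin \o A) x 1.
  by apply: diff_derivable; apply: differentiable_comp; apply/derivable1_diffP.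
have cF : continuous F.
  move=> x; apply: cvgM; first exact: cvg_cst.
  by apply: differentiable_continuous; exact/derivable1_diffP.
have := @continuous_FTC2 R (fun x => cos (w * x + p)) F l h lh.
rewrite /Rintegral => -> //.
- by rewrite /F /A/= mulrBr.
- apply: continuous_subspaceT => x.
  apply: (@continuous_comp _ _ _ A cos); last exact: continuous_cos.
  by apply: differentiable_continuous; apply/derivable1_diffP.
- split; first by move=> x _; apply: derivableM.
    by apply: cvg_at_right_filter; exact: cF.
  by apply: cvg_at_left_filter; exact: cF.
- move=> x _; rewrite /F derive1Ml//.
  rewrite (@derive1_comp _ A sin)//.
  by rewrite !derive1E !derive_val /A; field.
Qed.

Lemma measurable_cos (R : realType) : measurable_fun setT (@cos R).
Proof. by apply: continuous_measurable_fun; exact: continuous_cos. Qed.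

(** Up to endpoints, [D] is the interval from [inf D] to [sup D], and the primitive takes values in
    an interval of length 2 / |w|. The bound depends neither on [D] nor on [p], which the later
    inductions need. *)
Lemma interval_oscillation_bound (R : realType) (D : set R) (w p M : R) :
  is_interval D -> D `<=` `[- M, M] -> w != 0 ->
  `|\int[@lebesgue_measure R]_x (\1_D x * cos (w * x + p))| <= 2 / `|w|.
Proof.
move=> iD DM w0.
have mcos : measurable_fun setT (fun x : R => cos (w * x + p)).
  by apply: measurableT_comp; [exact: measurable_cos|exact: measurable_affine].
have -> : \int[@lebesgue_measure R]_x (\1_D x * cos (w * x + p)) =
          \int[@lebesgue_measure R]_(x in D) cos (w * x + p).
  rewrite [RHS]Rintegral_mkcond; apply: eq_Rintegral => x _.
  by rewrite patchE indicE; case: ifP => _; rewrite ?mul1r ?mul0r.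
have [D0|/set0P[x0 Dx0]] := eqVneq D set0.
  by rewrite D0 Rintegral_set0 normr0 divr_ge0.
have lD : has_lbound D by exists (- M) => x /DM/=; rewrite in_itv/= => /andP[].
have uD : has_ubound D by exists M => x /DM/=; rewrite in_itv/= => /andP[].
have lh : inf D <= sup D.
  by apply: (@le_trans _ _ x0); [apply: ge_inf|apply: ub_le_sup].
have -> : \int[@lebesgue_measure R]_(x in D) cos (w * x + p) =
    \int[@lebesgue_measure R]_(x in `[inf D, sup D]) cos (w * x + p).
  rewrite [in LHS]((is_intervalP D).1 iD) /Rhull (asboolT lD) (asboolT uD).
  have mcos' : measurable_fun `]inf D, sup D[ (EFin \o (fun x : R => cos (w * x + p))).
    by apply/measurable_EFinP; exact: measurable_funTS.
  rewrite /Rintegral; congr fine; rewrite (integral_itv_bndoo _ _ mcos').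
  by rewrite (integral_itv_bndoo true false mcos').
rewrite integral_cos_affine// normrM normfV mulrC ler_wpM2r ?invr_ge0//.
have := sin_le1 (w * sup D + p); have := sin_geN1 (w * sup D + p).
have := sin_le1 (w * inf D + p); have := sin_geN1 (w * inf D + p).
by rewrite ler_norml; lra.
Qed.

(** * Iterated integrals of bounded Borel functions with bounded support *)

(** The very vector that [iint] builds, so [iintS] holds by computation. *)
Definition scons (R : realType) m (t : R) (y : 'rV[R]_m) : 'rV[R]_m.+1 :=
  row_mx (const_mx t : 'rV_1) y.

Definition stail (R : realType) m (x : 'rV[R]_m.+1) : 'rV[R]_m :=
  \row_j x ord0 (lift ord0 j).

Lemma scons_head (R : realType) m (t : R) (y : 'rV[R]_m) : scons t y ord0 ord0 = t.
Proof.
transitivity (row_mx (const_mx t : 'rV_1) y ord0 (lshift m ord0)).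
  by congr fun_of_matrix; exact: val_inj.
by rewrite row_mxEl mxE.
Qed.

Lemma scons_lift (R : realType) m (t : R) (y : 'rV[R]_m) j :
  scons t y ord0 (lift ord0 j) = y ord0 j.
Proof.
transitivity (row_mx (const_mx t : 'rV_1) y ord0 (rshift 1 j)).
  by congr fun_of_matrix; exact: val_inj.
by rewrite row_mxEr.
Qed.

Lemma stailK (R : realType) m (t : R) (y : 'rV[R]_m) : stail (scons t y) = y.
Proof. by apply/rowP => j; rewrite mxE scons_lift. Qed.

Lemma scons_stail (R : realType) m (x : 'rV[R]_m.+1) : scons (x ord0 ord0) (stail x) = x.
Proof.
apply/rowP => i; case: (unliftP ord0 i) => [j|] ->; first by rewrite scons_lift mxE.
by rewrite scons_head.
Qed.

Lemma iintS (R : realType) m (f : 'rV[R]_m.+1 -> R) :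
  iint f = \int[@lebesgue_measure R]_t iint (fun y => f (scons t y)).
Proof. by []. Qed.

Lemma eq_iint (R : realType) m (f g : 'rV[R]_m -> R) : f =1 g -> iint f = iint g.
Proof. by move=> fg; congr iint; apply/funext. Qed.

Definition measurable_row (R : realType) d (T : measurableType d) n
    (h : T -> 'rV[R]_n) : Prop :=
  forall i, measurable_fun setT (fun t => h t ord0 i).

(* Borel measurability on R^n, tested on all maps into R^n with measurable coordinates: no
   sigma-algebra on row vectors is needed. *)
Definition borel (R : realType) n (f : 'rV[R]_n -> R) : Prop :=
  forall d (T : measurableType d) (h : T -> 'rV[R]_n),
    measurable_row h -> measurable_fun setT (f \o h).

Lemma measurable_scons (R : realType) d (T : measurableType d) m
    (a : T -> R) (h : T -> 'rV[R]_m) :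
  measurable_fun setT a -> measurable_row h ->
  measurable_row (fun t => scons (a t) (h t)).
Proof.
move=> ma mh i; case: (unliftP ord0 i) => [j|] ->.
  by under eq_fun do rewrite scons_lift; exact: mh.
by under eq_fun do rewrite scons_head.
Qed.

(** The hypothesis ranges over all measurable reparametrizations so that the induction can enlarge
    the parameter space from [T] to [T * R], absorbing the first coordinate into the parameter. *)
Lemma measurable_iint_param (R : realType) m d (T : measurableType d)
    (F : T -> 'rV[R]_m -> R) :
  (forall d' (T' : measurableType d') (a : T' -> T) (h : T' -> 'rV[R]_m),
     measurable_fun setT a -> measurable_row h ->
     measurable_fun setT (fun t => F (a t) (h t))) ->
  measurable_fun setT (fun t => iint (F t)).
Proof.
elim: m d T F => [|m IH] d T F mF.
  by apply: mF => // -[].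
under eq_fun do rewrite iintS.
apply: (measurable_Rintegral_param (g := fun p : T * R => iint (fun y => F p.1 (scons p.2 y)))).
apply: IH => d' T' a h ma mh.
apply: (mF _ _ (fun t => (a t).1)); first by apply: measurableT_comp.
by apply: measurable_scons => //; apply: measurableT_comp.
Qed.

(** The class on which [iint] is shown to be linear and compatible with Fubini and with linear
    changes of variables; it contains every bounded Borel function cut off by a bounded Borel
    set. *)
Definition nice (R : realType) n (f : 'rV[R]_n -> R) : Prop :=
  borel f /\ exists K : R, forall x, `|f x| <= K /\
    (f x != 0 -> forall i, `|x ord0 i| <= K).

Lemma borel_section (R : realType) m (f : 'rV[R]_m.+1 -> R) t :
  borel f -> borel (fun y => f (scons t y)).
Proof.
by move=> bf d T h mh; apply: (bf _ _ (fun u => scons t (h u))); exact: measurable_scons.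
Qed.

Lemma nice_section (R : realType) m (f : 'rV[R]_m.+1 -> R) t :
  nice f -> nice (fun y => f (scons t y)).
Proof.
move=> [bf [K fK]]; split; first exact: borel_section.
exists K => y; have [? fy] := fK (scons t y); split => // /fy yK i.
by have := yK (lift ord0 i); rewrite scons_lift.
Qed.

Lemma nice_column (R : realType) m (f : 'rV[R]_m.+1 -> R) y :
  nice f -> measurable_fun setT (fun t => f (scons t y)) /\
            bounded_support1 (fun t => f (scons t y)).
Proof.
move=> [bf [K fK]]; split.
  by apply: (bf _ _ (fun t => scons t y)); apply: measurable_scons.
exists K => t; have [? fy] := fK (scons t y); split => // /fy/(_ ord0).
by rewrite scons_head.
Qed.

Lemma nice_column_integrable (R : realType) m (f : 'rV[R]_m.+1 -> R) y :
  nice f -> (@lebesgue_measure R).-integrable setT (EFin \o (fun t => f (scons t y))).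
Proof. by move=> /(nice_column y)[]; exact: bounded_support1_integrable. Qed.

Lemma measurable_iint_section (R : realType) m (f : 'rV[R]_m.+1 -> R) :
  borel f -> measurable_fun setT (fun t => iint (fun y => f (scons t y))).
Proof.
move=> bf; apply: measurable_iint_param => d T a h ma mh.
by apply: (bf _ _ (fun u => scons (a u) (h u))); exact: measurable_scons.
Qed.

Lemma iint0 (R : realType) m : iint (fun _ : 'rV[R]_m => 0) = 0.
Proof.
elim: m => // m IH; rewrite iintS.
rewrite (_ : (fun t => _) = cst 0) ?Rintegral_cst ?mul0r//.
by apply/funext => t /=; rewrite IH.
Qed.

Lemma iint_bound (R : realType) m (f : 'rV[R]_m -> R) (C M : R) :
  borel f -> 0 <= M ->
  (forall x, `|f x| <= C /\ (f x != 0 -> forall i, `|x ord0 i| <= M)) ->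
  `|iint f| <= (2 * M) ^+ m * C.
Proof.
elim: m f => [|m IH] f bf M0 fC; first by rewrite expr0 mul1r; exact: (fC 0).1.
rewrite iintS exprS -mulrA; apply: Rintegral_bound => //.
  exact: measurable_iint_section.
move=> t; split.
  apply: IH => //; first exact: borel_section.
  move=> y; have [? fy] := fC (scons t y); split => // /fy yM i.
  by have := yM (lift ord0 i); rewrite scons_lift.
apply: contraNT => tM; apply/eqP; rewrite -[RHS](iint0 R m); apply: eq_iint => y.
apply/eqP; apply: contraNT tM => /(fC (scons t y)).2/(_ ord0).
by rewrite scons_head.
Qed.

Lemma nice_iint_section (R : realType) m (f : 'rV[R]_m.+1 -> R) :
  nice f -> bounded_support1 (fun t => iint (fun y => f (scons t y))).
Proof.
move=> [bf [K fK]]; have K0 : 0 <= K by apply: le_trans (fK 0).1.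
exists (Num.max K ((2 * K) ^+ m * K)) => t; split.
  rewrite le_max; apply/orP; right; apply: iint_bound => //; first exact: borel_section.
  move=> y; have [? fy] := fK (scons t y); split => // /fy yM i.
  by have := yM (lift ord0 i); rewrite scons_lift.
rewrite le_max => ne0; apply/orP; left; apply: contraNT ne0 => tM.
apply/eqP; rewrite -[RHS](iint0 R m); apply: eq_iint => y.
apply/eqP; apply: contraNT tM => /(fK (scons t y)).2/(_ ord0).
by rewrite scons_head.
Qed.

Lemma nice_iint_integrable (R : realType) m (f : 'rV[R]_m.+1 -> R) : nice f ->
  (@lebesgue_measure R).-integrable setT (EFin \o (fun t => iint (fun y => f (scons t y)))).
Proof.
move=> nf; apply: bounded_support1_integrable; last exact: nice_iint_section.
by apply: measurable_iint_section; case: nf.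
Qed.

Lemma iintD (R : realType) m (f g : 'rV[R]_m -> R) : nice f -> nice g ->
  iint (fun x => f x + g x) = iint f + iint g.
Proof.
elim: m f g => // m IH f g nf ng; rewrite !iintS.
rewrite -RintegralD//; [|exact: nice_iint_integrable..].
by apply: eq_Rintegral => t _; rewrite IH//; exact: nice_section.
Qed.

Lemma iintZ (R : realType) m (c : R) (f : 'rV[R]_m -> R) : nice f ->
  iint (fun x => c * f x) = c * iint f.
Proof.
elim: m f => // m IH f nf; rewrite !iintS.
rewrite -RintegralZl//; last exact: nice_iint_integrable.
by apply: eq_Rintegral => t _; rewrite IH//; exact: nice_section.
Qed.

(** Moves the first coordinate from the outermost to the innermost integral. One-dimensional Fubini
    exchanges the first two coordinates; the induction hypothesis then applies to [fu u], which is
    [f] with its second coordinate frozen at [u]. *)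
Lemma iint_swap (R : realType) m (f : 'rV[R]_m.+1 -> R) : nice f ->
  iint f = iint (fun y => \int[@lebesgue_measure R]_t f (scons t y)).
Proof.
elim: m f => [//|m IH] f [bf [K fK]].
have K0 : 0 <= K by apply: le_trans (fK 0).1.
pose fu u (x : 'rV[R]_m.+1) := f (scons (x ord0 ord0) (scons u (stail x))).
have nfu u : nice (fu u).
  split.
    move=> d T h mh; apply: (bf _ _ (fun z => scons (h z ord0 ord0) (scons u (stail (h z))))).
    apply: measurable_scons => //; apply: measurable_scons => // j.
    by under eq_fun do rewrite mxE; exact: mh.
  exists K => x; rewrite /fu; set z := scons _ _; have [? fz] := fK z; split => // /fz zK i.
  case: (unliftP ord0 i) => [j|] ->.
    by have := zK (lift ord0 (lift ord0 j)); rewrite !scons_lift mxE.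
  by have := zK ord0; rewrite scons_head.
rewrite [RHS]iintS.
transitivity (\int[@lebesgue_measure R]_u iint (fu u)); last first.
  apply: eq_Rintegral => u _; rewrite IH//; apply: eq_iint => y.
  by apply: eq_Rintegral => t _; rewrite /fu scons_head stailK.
rewrite iintS; under eq_Rintegral do rewrite iintS.
have zK t u z : f (scons t (scons u z)) != 0 ->
    [/\ `|t| <= K, `|u| <= K & forall i, `|z ord0 i| <= K].
  move=> /(fK _).2 xK; split.
  - by have := xK ord0; rewrite scons_head.
  - by have := xK (lift ord0 ord0); rewrite scons_lift scons_head.
  - by move=> i; have := xK (lift ord0 (lift ord0 i)); rewrite !scons_lift.
pose G (p : R * R) := iint (fun z => f (scons p.1 (scons p.2 z))).
have mG : measurable_fun setT G.
  apply: measurable_iint_param => d T a h ma mh.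
  apply: (bf _ _ (fun z => scons (a z).1 (scons (a z).2 (h z)))).
  by do 2 (apply: measurable_scons; first by apply: measurableT_comp).
have GK p : `|G p| <= Num.max K ((2 * K) ^+ m * K) /\
    (G p != 0 -> `|p.1| <= Num.max K ((2 * K) ^+ m * K) /\
                 `|p.2| <= Num.max K ((2 * K) ^+ m * K)).
  split.
    rewrite le_max; apply/orP; right; apply: iint_bound => //.
      by apply: (borel_section (f := fun x => f (scons p.1 x))); exact: borel_section.
    by move=> z; split; [exact: (fK _).1|move=> /zK[]].
  move=> ne0; suff [? ?] : `|p.1| <= K /\ `|p.2| <= K by rewrite !le_max; split; apply/orP; left.
  apply: contrapT => tu; move/eqP: ne0; apply; rewrite -[RHS](iint0 R m); apply: eq_iint => z.
  by apply/eqP; apply/negP => /negP/zK[? ? _]; apply: tu.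
apply: (eq_trans (Rintegral_swap mG GK)).
apply: eq_Rintegral => u _; rewrite [RHS]iintS; apply: eq_Rintegral => t _.
by apply: eq_iint => z; rewrite /fu scons_head stailK.
Qed.

Lemma nice_integral_column (R : realType) m (f : 'rV[R]_m.+1 -> R) : nice f ->
  nice (fun y => \int[@lebesgue_measure R]_t f (scons t y)).
Proof.
move=> [bf [K fK]]; have K0 : 0 <= K by apply: le_trans (fK 0).1.
split.
  move=> d T h mh.
  apply: (measurable_Rintegral_param (g := fun p : T * R => f (scons p.2 (h p.1)))).
  apply: (bf _ _ (fun p : T * R => scons p.2 (h p.1))); apply: measurable_scons => // i.
  by apply: (measurableT_comp (mh i)).
exists (Num.max K (2 * K * K)) => y; split.
  rewrite le_max; apply/orP; right; apply: Rintegral_bound => //.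
    by apply: (bf _ _ (fun t => scons t y)); apply: measurable_scons.
  move=> t; have [? fy] := fK (scons t y); split => // /fy/(_ ord0).
  by rewrite scons_head.
move=> ne0 i; rewrite le_max; apply/orP; left; apply: contraNT ne0 => yK.
rewrite (_ : (fun t => _) = cst 0) ?Rintegral_cst ?mul0r//.
apply/funext => t /=; apply/eqP; apply: contraNT yK => /(fK _).2/(_ (lift ord0 i)).
by rewrite scons_lift.
Qed.

(** * Linear change of variables *)

Lemma borel_mulmx (R : realType) m n (f : 'rV[R]_n -> R) (A : 'M[R]_(m, n)) (v : 'rV[R]_n) :
  borel f -> borel (fun x => f (x *m A + v)).
Proof.
move=> bf d T h mh; apply: (bf _ _ (fun t => h t *m A + v)) => i.
under eq_fun do rewrite !mxE.
apply: measurable_funD => //; apply: measurable_sum => j.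
by apply: measurable_funM => //; exact: mh.
Qed.

(** The clause [K <= C] lets the single constant required by [nice] bound the values as well as the
    support. *)
Lemma mulmx_bounded (R : realType) m n (A : 'M[R]_(m, n)) (K : R) : 0 <= K ->
  exists2 C, K <= C & forall x : 'rV[R]_m, (forall i, `|x ord0 i| <= K) ->
    forall j, `|(x *m A) ord0 j| <= C.
Proof.
move=> K0; exists (K + K * \sum_i \sum_j `|A i j|).
  by rewrite lerDl mulr_ge0// sumr_ge0// => i _; rewrite sumr_ge0.
move=> x xK j; rewrite mxE (le_trans (ler_norm_sum _ _ _))//.
rewrite (@le_trans _ _ (K * \sum_i \sum_j `|A i j|))// ?lerDr// mulr_sumr ler_sum// => i _.
rewrite normrM ler_pM// (bigD1 j)//= lerDl sumr_ge0//.
Qed.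

Lemma nice_mulmx (R : realType) m (f : 'rV[R]_m -> R) (A : 'M[R]_m) :
  A \in unitmx -> nice f -> nice (fun x => f (x *m A)).
Proof.
move=> uA [bf [K fK]]; have K0 : 0 <= K by apply: le_trans (fK 0).1.
split.
  have := @borel_mulmx R m m f A 0 bf.
  by congr borel; apply/funext => x; rewrite addr0.
have [C KC CA] := mulmx_bounded (invmx A) K0.
exists C => x; split; first exact: le_trans (fK _).1 KC.
by move=> /(fK _).2/CA; rewrite mulmxK.
Qed.

Lemma nice_shift (R : realType) m (f : 'rV[R]_m -> R) (v : 'rV[R]_m) :
  nice f -> nice (fun x => f (x + v)).
Proof.
move=> [bf [K fK]]; have K0 : 0 <= K by apply: le_trans (fK 0).1.
split.
  have := @borel_mulmx R m m f 1%:M v bf.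
  by congr borel; apply/funext => x; rewrite mulmx1.
exists (K + \sum_i `|v ord0 i|) => x; split.
  by rewrite (le_trans (fK _).1)// lerDl sumr_ge0.
move=> /(fK _).2 xK i.
have -> : x ord0 i = (x + v) ord0 i - v ord0 i by rewrite mxE addrK.
rewrite (le_trans (ler_normB _ _))// lerD//.
by rewrite (bigD1 i)//= lerDl sumr_ge0.
Qed.

Lemma scons_add (R : realType) m (t u : R) (y z : 'rV[R]_m) :
  scons t y + scons u z = scons (t + u) (y + z).
Proof.
by apply/rowP => i; rewrite mxE; case: (unliftP ord0 i) => [j|] ->;
  rewrite ?scons_lift ?scons_head ?mxE.
Qed.

Lemma iint_translate (R : realType) m (f : 'rV[R]_m -> R) (v : 'rV[R]_m) :
  nice f -> iint (fun x => f (x + v)) = iint f.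
Proof.
elim: m f v => [|m IH] f v nf; first by rewrite /= (thinmx0 v) addr0.
rewrite !iintS.
under eq_Rintegral => t _.
  rewrite (_ : iint _ = iint (fun y => f (scons (1 * t + v ord0 ord0) y))); last first.
    rewrite -(IH _ (stail v) (nice_section _ nf)); apply: eq_iint => y.
    by rewrite mul1r -[in LHS](scons_stail v) scons_add.
  over.
rewrite (@Rintegral_affine _ 1 _ (fun t => iint (fun y => f (scons t y)))) ?oner_eq0//.
  by rewrite normr1 invr1 mul1r.
exact: nice_iint_integrable.
Qed.

Lemma const_mx1 (R : realType) (t : R) : const_mx t = t%:M :> 'M[R]_1.
Proof. by apply/matrixP => i j; rewrite !ord1 !mxE. Qed.

Lemma scons_block (R : realType) m (t a : R) (y r : 'rV[R]_m) (c : 'cV[R]_m) (A : 'M[R]_m) :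
  scons t y *m (block_mx a%:M r c A : 'M[R]_m.+1) =
  scons (t * a + (y *m c) ord0 ord0) (t *: r + y *m A).
Proof.
rewrite /scons; rewrite (@mul_row_block _ 1 1 m 1 m) !const_mx1 mul_scalar_mx.
rewrite mul_scalar_mx scale_scalar_mx [X in _ + X](mx11_scalar (y *m c)).
by rewrite -(raddfD (scalar_mx (n := 1))).
Qed.

Definition iint_linear (R : realType) m (A : 'M[R]_m) : Prop :=
  forall f, nice f -> iint (fun x => f (x *m A)) = `|\det A|^-1 * iint f.

(** The map is (t, y) -> (a t, t r + y A). For fixed [t] it is [A] followed by a translation; the
    outer integral is a scaling of the line. *)
Lemma iint_linear_ublock (R : realType) m (a : R) (r : 'rV[R]_m) (A : 'M[R]_m) :
  a != 0 -> A \in unitmx -> iint_linear A ->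
  iint_linear (block_mx a%:M r 0 A : 'M[R]_m.+1).
Proof.
move=> a0 uA lA f nf.
rewrite (det_ublock (a%:M : 'M[R]_1) r A) det_scalar1 normrM invfM.
rewrite !iintS.
under eq_Rintegral => t _.
  rewrite (_ : iint _ = `|\det A|^-1 * iint (fun y => f (scons (a * t + 0) y))); last first.
    have ns := nice_section (a * t + 0) nf.
    rewrite -(iint_translate (t *: r) ns) -(lA _ (nice_shift (t *: r) ns)).
    apply: eq_iint => y; rewrite scons_block mulmx0 mxE addrC [a * t]mulrC addr0 add0r.
    by rewrite [t *: r + _]addrC.
  over.
have ni := nice_iint_integrable nf.
rewrite RintegralZl//; last first.
  apply: bounded_support1_integrable.
    apply: (measurableT_comp (f := fun t => iint (fun y => f (scons t y)))).
      by apply: measurable_iint_section; case: nf.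
    exact: measurable_affine.
  have [K fK] := nice_iint_section nf; exists (Num.max K (K / `|a|)) => t.
  have [? tK] := fK (a * t + 0); split; first by rewrite le_max; apply/orP; left.
  move=> /tK; rewrite addr0 normrM mulrC -ler_pdivlMr ?normr_gt0// => ?.
  by rewrite le_max; apply/orP; right.
rewrite (@Rintegral_affine _ a 0 (fun t => iint (fun y => f (scons t y))))//.
by rewrite mulrCA mulrA.
Qed.

(** The map is (t, y) -> (t + y c, y), a translation in [t] for fixed [y]; hence [t] must first
    become the innermost variable. *)
Lemma iint_linear_shear (R : realType) m (c : 'cV[R]_m) :
  iint_linear (block_mx 1%:M 0 c 1%:M : 'M[R]_m.+1).
Proof.
move=> f nf.
rewrite (det_lblock (1%:M : 'M[R]_1) c 1%:M) !det1 mulr1 normr1 invr1 mul1r.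
rewrite iint_swap; last first.
  apply: nice_mulmx => //.
  by rewrite unitmxE (det_lblock (1%:M : 'M[R]_1) c 1%:M) !det1 mulr1 unitr1.
rewrite [RHS]iint_swap//; apply: eq_iint => y.
have ic := nice_column_integrable y nf.
have := Rintegral_affine ((y *m c) ord0 ord0) (oner_neq0 R) ic.
rewrite normr1 invr1 mul1r => <-; apply: eq_Rintegral => t _.
by rewrite scons_block scaler0 add0r mulmx1 mulr1 mul1r.
Qed.

Lemma iint_linear_mul (R : realType) m (A B : 'M[R]_m) :
  B \in unitmx -> iint_linear A -> iint_linear B -> iint_linear (A *m B).
Proof.
move=> uB lA lB f nf; under eq_iint do rewrite mulmxA.
rewrite (lA (fun x => f (x *m B))); last exact: nice_mulmx.
by rewrite lB// det_mulmx normrM invfM mulrA.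
Qed.

Lemma iint_linear1 (R : realType) m : iint_linear (1%:M : 'M[R]_m).
Proof.
move=> f nf; rewrite det1 normr1 invr1 mul1r; apply: eq_iint => x.
by rewrite mulmx1.
Qed.

(** Gaussian elimination: an invertible matrix with nonzero corner is a shear times an upper block
    matrix, to whose lower block the induction applies. *)
Theorem iint_linear_unit (R : realType) m (A : 'M[R]_m) : A \in unitmx -> iint_linear A.
Proof.
elim: m A => [|m IH] A uA.
  by move=> f nf /=; rewrite det_mx00 normr1 invr1 mul1r thinmx0.
have main (a : R) (r : 'rV[R]_m) (c : 'cV[R]_m) (A' : 'M[R]_m) : a != 0 ->
    (block_mx a%:M r c A' : 'M[R]_m.+1) \in unitmx ->
    iint_linear (block_mx a%:M r c A' : 'M[R]_m.+1).
  (* [S] is the Schur complement of the corner [a]; it inherits invertibility through the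
     determinant. *)
  move=> a0 uB; pose S := A' - a^-1 *: (c *m r).
  have BE : block_mx a%:M r c A' =
      (block_mx 1%:M 0 (a^-1 *: c) 1%:M *m block_mx a%:M r 0 S : 'M[R]_m.+1).
    rewrite (@mulmx_block _ 1 m 1 m 1 m) !mul1mx !mul0mx !addr0.
    rewrite -scalemxAl mul_mx_scalar scalerA mulVf// scale1r.
    by congr block_mx; rewrite -scalemxAl addrC subrK.
  have uS : S \in unitmx.
    move: uB; rewrite BE unitmx_mul => /andP[_].
    by rewrite !unitmxE (det_ublock (a%:M : 'M[R]_1) r S) unitrM => /andP[].
  rewrite BE; apply: iint_linear_mul.
  - by move: uB; rewrite BE unitmx_mul => /andP[].
  - exact: iint_linear_shear.
  - by apply: iint_linear_ublock => //; exact: IH.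
have AE : A = block_mx ((A ord0 ord0)%:M : 'M[R]_1) (@ursubmx _ 1 m 1 m A)
    (@dlsubmx _ 1 m 1 m A) (@drsubmx _ 1 m 1 m A).
  have U : @ulsubmx _ 1 m 1 m A = (A ord0 ord0)%:M.
    by rewrite [LHS]mx11_scalar; congr (_%:M); rewrite !mxE; congr (A _ _); apply: val_inj.
  by rewrite -U (@submxK _ 1 m 1 m).
move: AE uA; move: (A ord0 ord0) (ursubmx _) (dlsubmx _) (drsubmx _) => a r c A' -> uA.
have [a0|a0] := eqVneq a 0; last exact: main.
(* A zero corner is repaired by adding to the first row one with nonzero first entry; it exists
   because the matrix is invertible. *)
have [i ci] : exists i, c i ord0 != 0.
  apply: contrapT => nc; have c0 : c = 0.
    apply/colP => i; rewrite [RHS]mxE; apply/eqP; apply/negP => ci; apply: nc.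
    by exists i; apply/negP.
  move: uA; rewrite c0 unitmxE (det_ublock (a%:M : 'M[R]_1) r A') a0 det_scalar1 mul0r.
  by rewrite unitr0.
(* Left multiplication by [V e] adds [e] times the row [i] of the lower block to the first row, so
   [V (-1)] undoes [V 1]. *)
pose V (e : R) : 'M[R]_m.+1 := block_mx (1%:M : 'M[R]_1) (e *: delta_mx ord0 i) 0 1%:M.
have VV : V (-1) *m V 1 = 1%:M.
  rewrite /V (@mulmx_block _ 1 m 1 m 1 m) !mul1mx !mulmx1 !mul0mx !mulmx0 !addr0 !add0r.
  by rewrite scaleN1r scale1r subrr -scalar_mx_block.
have uV e : V e \in unitmx.
  by rewrite unitmxE (det_ublock (1%:M : 'M[R]_1)) !det1 mulr1 unitr1.
have lV e : iint_linear (V e).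
  by apply: iint_linear_ublock; rewrite ?oner_eq0 ?unitmx1//; exact: iint_linear1.
set B := (block_mx _ _ _ _) in uA *.
have VB : V 1 *m B = block_mx ((c i ord0)%:M : 'M[R]_1) (r + row i A') c A'.
  rewrite /V /B (@mulmx_block _ 1 m 1 m 1 m) !mul1mx !mul0mx !add0r scale1r -!rowE a0.
  have -> : 0%:M + row i c = (c i ord0)%:M.
    by rewrite [LHS]mx11_scalar; congr (_%:M); rewrite !mxE mul0rn add0r.
  by [].
have -> : B = V (-1) *m (V 1 *m B) by rewrite mulmxA VV mul1mx.
have uVB : V 1 *m B \in unitmx by rewrite unitmx_mul uV.
apply: iint_linear_mul => //; rewrite VB; apply: main => //.
by rewrite -VB.
Qed.

Lemma orthogonal_unitmx (R : realType) m (O : 'M[R]_m) : O *m O^T = 1%:M -> O \in unitmx.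
Proof. by move=> /mulmx1_unit[]. Qed.

Lemma iint_orthogonal (R : realType) m (O : 'M[R]_m) (f : 'rV[R]_m -> R) :
  O *m O^T = 1%:M -> nice f -> iint (fun x => f (x *m O)) = iint f.
Proof.
move=> OO nf; rewrite iint_linear_unit//; last exact: orthogonal_unitmx.
have : \det O ^+ 2 = 1 by rewrite expr2 -{2}det_tr -det_mulmx OO det1.
move=> /eqP; rewrite sqrf_eq1 => /orP[] /eqP ->; by rewrite ?normrN normr1 invr1 mul1r.
Qed.

(** * Oscillatory integrals with piecewise affine phase *)

Lemma borel_cst (R : realType) n (c : R) : borel (fun _ : 'rV[R]_n => c).
Proof. by move=> d T h mh; exact: measurable_cst. Qed.

Lemma borelD (R : realType) n (f g : 'rV[R]_n -> R) :
  borel f -> borel g -> borel (fun x => f x + g x).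
Proof.
by move=> bf bg d T h mh; apply: (measurable_funD (bf _ _ h mh) (bg _ _ h mh)).
Qed.

Lemma borelM (R : realType) n (f g : 'rV[R]_n -> R) :
  borel f -> borel g -> borel (fun x => f x * g x).
Proof.
by move=> bf bg d T h mh; apply: (measurable_funM (bf _ _ h mh) (bg _ _ h mh)).
Qed.

Lemma borel_comp (R : realType) n (f : 'rV[R]_n -> R) (g : R -> R) :
  measurable_fun setT g -> borel f -> borel (fun x => g (f x)).
Proof.
by move=> mg bf d T h mh; apply: (measurableT_comp mg (bf _ _ h mh)).
Qed.

Lemma borel_dotv (R : realType) n (c : 'rV[R]_n) : borel (dotv c).
Proof.
move=> d T h mh; rewrite /comp /dotv; apply: measurable_sum => i.
by apply: measurable_funM => //; exact: mh.
Qed.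

Definition borel_set (R : realType) n (A : set 'rV[R]_n) : Prop :=
  borel (fun x => \1_A x : R).

Lemma measurable_fun_bool_R (R : realType) d (T : measurableType d) (f : T -> bool) :
  measurable_fun setT f -> measurable_fun setT (fun x => (f x)%:R : R).
Proof. by move=> mf; apply: (measurableT_comp (f := fun b : bool => b%:R : R)). Qed.

Lemma borel_set_lt (R : realType) n (f g : 'rV[R]_n -> R) :
  borel f -> borel g -> borel_set [set x | f x < g x].
Proof.
move=> bf bg d T h mh.
have := measurable_fun_bool_R (R := R) (measurable_fun_ltr (bf _ _ h mh) (bg _ _ h mh)).
congr measurable_fun; apply/funext => x /=; rewrite indicE; congr (nat_of_bool _)%:R.
by apply/idP/idP; rewrite ?inE//= => ?; apply/mem_set.
Qed.

Lemma borel_set_le (R : realType) n (f g : 'rV[R]_n -> R) :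
  borel f -> borel g -> borel_set [set x | f x <= g x].
Proof.
move=> bf bg d T h mh.
have := measurable_fun_bool_R (R := R) (measurable_fun_ler (bf _ _ h mh) (bg _ _ h mh)).
congr measurable_fun; apply/funext => x /=; rewrite indicE; congr (nat_of_bool _)%:R.
by apply/idP/idP; rewrite ?inE//= => ?; apply/mem_set.
Qed.

Lemma borel_setI (R : realType) n (A B : set 'rV[R]_n) :
  borel_set A -> borel_set B -> borel_set (A `&` B).
Proof.
move=> bA bB; have := borelM bA bB; congr borel; apply/funext => x.
by rewrite indicI.
Qed.

Definition convex_set_rV (R : realType) n (K : set 'rV[R]_n) : Prop :=
  forall x y t, K x -> K y -> 0 <= t <= 1 -> K (t *: x + (1 - t) *: y).

(** [M] is a parameter because the constants below depend on the cube but not on the set inside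
    it. *)
Definition convex_body (R : realType) n (M : R) (K : set 'rV[R]_n) : Prop :=
  [/\ borel_set K, forall x, K x -> forall i, `|x ord0 i| <= M & convex_set_rV K].

Lemma dotvDr (R : realType) n (c x y : 'rV[R]_n) : dotv c (x + y) = dotv c x + dotv c y.
Proof. by rewrite /dotv -big_split/=; apply: eq_bigr => i _; rewrite mxE mulrDr. Qed.

Lemma dotvZr (R : realType) n (c x : 'rV[R]_n) t : dotv c (t *: x) = t * dotv c x.
Proof. by rewrite /dotv mulr_sumr; apply: eq_bigr => i _; rewrite mxE mulrCA. Qed.

Lemma dotvC (R : realType) n (x y : 'rV[R]_n) : dotv x y = dotv y x.
Proof. by rewrite /dotv; apply: eq_bigr => i _; rewrite mulrC. Qed.

Lemma dotv0l (R : realType) n (x : 'rV[R]_n) : dotv 0 x = 0.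
Proof. by rewrite /dotv big1// => i _; rewrite mxE mul0r. Qed.

Lemma dotv_scons (R : realType) n (c : 'rV[R]_n.+1) t y :
  dotv c (scons t y) = c ord0 ord0 * t + dotv (stail c) y.
Proof.
rewrite /dotv big_ord_recl scons_head; congr (_ + _).
by apply: eq_bigr => i _; rewrite scons_lift mxE.
Qed.

Lemma scons_scale (R : realType) m (e t : R) (y : 'rV[R]_m) :
  e *: scons t y = scons (e * t) (e *: y).
Proof.
apply/rowP => i; rewrite [LHS]mxE; case: (unliftP ord0 i) => [j|] ->.
  by rewrite !scons_lift mxE.
by rewrite !scons_head.
Qed.

Lemma nice_indic_mul (R : realType) n (K : set 'rV[R]_n) (f : 'rV[R]_n -> R) (M C : R) :
  borel_set K -> (forall x, K x -> forall i, `|x ord0 i| <= M) ->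
  borel f -> (forall x, `|f x| <= C) -> nice (fun x => \1_K x * f x).
Proof.
move=> bK KM bf fC; split; first exact: borelM.
have C0 : 0 <= C by apply: le_trans (fC 0).
exists (Num.max C M) => x; rewrite indicE; case: (boolP (x \in K)) => [|_].
  rewrite inE mul1r => Kx; split; first by rewrite le_max fC.
  by move=> _ i; rewrite le_max KM// orbT.
by rewrite mul0r normr0 le_max C0 eqxx.
Qed.

Lemma nice_indic (R : realType) n (K : set 'rV[R]_n) (M : R) :
  borel_set K -> (forall x, K x -> forall i, `|x ord0 i| <= M) ->
  nice (fun x => \1_K x : R).
Proof.
move=> bK KM; have : nice (fun x => \1_K x * 1 : R).
  by apply: (nice_indic_mul bK KM (borel_cst 1) (C := 1)) => x; rewrite normr1.
by congr nice; apply/funext => x; rewrite mulr1.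
Qed.

Lemma cos_norm_le1 (R : realType) (x : R) : `|cos x| <= 1.
Proof. by rewrite ler_norml cos_geN1 cos_le1. Qed.

Lemma borel_cos_comp (R : realType) n (f : 'rV[R]_n -> R) (w p : R) :
  borel f -> borel (fun x => cos (w * f x + p)).
Proof.
move=> bf; apply: (borel_comp (g := fun t : R => cos (w * t + p))) => //.
by apply: measurableT_comp; [exact: measurable_cos|exact: measurable_affine].
Qed.

Lemma convex_body_section (R : realType) n (M : R) (K : set 'rV[R]_n.+1) t :
  convex_body M K -> convex_body M [set y | K (scons t y)].
Proof.
move=> [bK KM cK]; split.
- by have := borel_section t bK; congr borel; apply/funext => y; rewrite !indicE.
- by move=> y /= /KM yM i; have := yM (lift ord0 i); rewrite scons_lift.
- move=> x y e /= Kx Ky e01; have := cK _ _ _ Kx Ky e01.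
  by rewrite !scons_scale scons_add -mulrDl addrC subrK mul1r.
Qed.

Lemma convex_body_column (R : realType) n (M : R) (K : set 'rV[R]_n.+1) y :
  convex_body M K -> is_interval [set t | K (scons t y)] /\
    [set t | K (scons t y)] `<=` `[- M, M].
Proof.
move=> [bK KM cK]; split.
  move=> s t /= Ks Kt u /andP[su ut].
  have [st|] := ltP s t; last first.
    by move=> ts; have <- : s = u by apply/eqP; rewrite eq_le su (le_trans ut ts).
  have ts0 : 0 < t - s by rewrite subr_gt0.
  have e01 : 0 <= (t - u) / (t - s) <= 1.
    by rewrite divr_ge0 ?ler_pdivrMr// ?mul1r; lra.
  have := cK _ _ _ Ks Kt e01; rewrite !scons_scale scons_add.
  rewrite -scalerDl [X in X *: y]addrC subrK scale1r; congr (K (scons _ _)).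
  by field; rewrite gt_eqF.
by move=> t /= /KM/(_ ord0); rewrite scons_head in_itv/= ler_norml.
Qed.

Lemma oscillation_bound (R : realType) m (c : 'rV[R]_m) (M : R) :
  c != 0 -> 0 <= M ->
  exists2 C : R, 0 <= C & forall K, convex_body M K -> forall w p : R, 0 < w ->
    `|iint (fun y => \1_K y * cos (w * dotv c y + p))| <= C / w.
Proof.
move=> + M0; elim: m c => [c|m IH c c0]; first by rewrite thinmx0 eqxx.
have nf K w p : convex_body M K -> nice (fun y => \1_K y * cos (w * dotv c y + p)).
  move=> [bK KM _]; apply: (nice_indic_mul (C := 1) bK KM).
    by apply: borel_cos_comp; exact: borel_dotv.
  by move=> x; exact: cos_norm_le1.
(* When only the first coordinate enters the phase, integrating it innermost gives the interval
   bound, and the other coordinates range over a cube of volume [(2 * M) ^+ m]. *)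
have [c'0|/IH[C C0 HC]] := eqVneq (stail c) 0.
  have c1 : c ord0 ord0 != 0.
    apply: contraNneq c0 => c1; rewrite -(scons_stail c) c1 c'0.
    by have := scons_scale 0 0 (0 : 'rV[R]_m); rewrite mul0r scaler0 scale0r => <-.
  exists ((2 * M) ^+ m * (2 / `|c ord0 ord0|)).
    by rewrite mulr_ge0// ?exprn_ge0 ?mulr_ge0// divr_ge0.
  move=> K bK w p w0; have nK := nf K w p bK; rewrite iint_swap// -mulrA.
  apply: iint_bound => //; first by have [] := nice_integral_column nK.
  move=> y.
  have -> : \int[@lebesgue_measure R]_t
      (\1_K (scons t y) * cos (w * dotv c (scons t y) + p)) =
    \int[@lebesgue_measure R]_t
      (\1_[set t | K (scons t y)] t * cos (w * c ord0 ord0 * t + p)).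
    apply: eq_Rintegral => t _; rewrite dotv_scons c'0 dotv0l addr0 mulrA.
    by rewrite !indicE.
  have [iK KM] := convex_body_column y bK; split.
    have wc : w * c ord0 ord0 != 0 by rewrite mulf_neq0// gt_eqF.
    have := interval_oscillation_bound p iK KM wc.
    by rewrite normrM (gtr0_norm w0) invfM mulrA mulrAC.
  move=> ne0 i; apply: contraNT ne0 => yM.
  rewrite (_ : (fun t => _) = cst 0) ?Rintegral_cst ?mul0r//.
  apply/funext => t /=; rewrite indicE; case: (boolP (_ \in _)) => [|_]; last by rewrite mul0r.
  rewrite inE/=; have [_ + _] := bK => KM' /KM'/(_ (lift ord0 i)).
  by rewrite scons_lift (negbTE yM).
(* The first coordinate ranges over an interval of length [2 * M], and [C / w] bounds the integral
   over each section. *)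
exists (2 * M * C); first by rewrite !mulr_ge0.
move=> K bK w p w0; have nK := nf K w p bK; rewrite iintS -(mulrA (2 * M)).
apply: Rintegral_bound => //; first by apply: (measurable_iint_section nK.1).
move=> t.
have -> : iint (fun y => \1_K (scons t y) * cos (w * dotv c (scons t y) + p)) =
  iint (fun y => \1_[set y | K (scons t y)] y *
                 cos (w * dotv (stail c) y + (w * (c ord0 ord0 * t) + p))).
  apply: eq_iint => y; rewrite !indicE dotv_scons; congr (_ * cos _); ring.
split; first by apply: HC => //; exact: convex_body_section.
apply: contraNT => tM; apply/eqP; rewrite -[RHS](iint0 R m); apply: eq_iint => y.
rewrite indicE; case: (boolP (_ \in _)) => [|_]; last by rewrite mul0r.
rewrite inE/=; have [_ + _] := bK => KM' /KM'/(_ ord0).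
by rewrite scons_head (negbTE tM).
Qed.

(** * Minima of finitely many affine functions *)

Definition affv (R : realType) m (u : 'rV[R]_m * R) (y : 'rV[R]_m) : R := dotv u.1 y + u.2.

(** A knockout form of the minimum: the first two entries are compared and the smaller one stays.
    Splitting a set along [affv u y <= affv v y] thus shortens the list on both sides. *)
Fixpoint minaff (R : realType) m (u : 'rV[R]_m * R) (us : seq ('rV[R]_m * R))
    (y : 'rV[R]_m) : R :=
  if us is v :: us' then
    if affv u y <= affv v y then minaff u us' y else minaff v us' y
  else affv u y.

Lemma minaff_le (R : realType) m (u : 'rV[R]_m * R) us y w :
  w \in u :: us -> minaff u us y <= affv w y.
Proof.
elim: us u w => [|v us IH] u w; first by rewrite inE => /eqP ->.
rewrite !inE/=; case: ifPn => uv.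
  move=> /or3P[/eqP ->|/eqP ->|wus]; last by apply: IH; rewrite inE wus orbT.
    by apply: IH; rewrite mem_head.
  by apply: le_trans uv; apply: IH; rewrite mem_head.
rewrite -ltNge in uv; move=> /or3P[/eqP ->|/eqP ->|wus]; last by apply: IH; rewrite inE wus orbT.
  by apply: le_trans (ltW uv); apply: IH; rewrite mem_head.
by apply: IH; rewrite mem_head.
Qed.

Lemma minaff_attained (R : realType) m (u : 'rV[R]_m * R) us y :
  exists2 w, w \in u :: us & minaff u us y = affv w y.
Proof.
elim: us u => [|v us IH] u; first by exists u; rewrite ?mem_head.
rewrite /=; case: ifPn => uv.
  by have [w] := IH u; rewrite inE => wus ->; exists w => //; rewrite !inE orbCA wus orbT.
by have [w] := IH v; rewrite inE => wus ->; exists w => //; rewrite !inE wus orbT.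
Qed.

Lemma le_minaff (R : realType) m (u : 'rV[R]_m * R) us y t :
  (t <= minaff u us y) = all (fun w => t <= affv w y) (u :: us).
Proof.
apply/idP/allP => [tm w wus|tall]; first exact: le_trans (minaff_le _ wus).
by have [w /tall + ->] := minaff_attained u us y.
Qed.

Lemma borel_affv (R : realType) m (u : 'rV[R]_m * R) : borel (affv u).
Proof. by apply: borelD; [exact: borel_dotv|exact: borel_cst]. Qed.

Lemma minaff_cons (R : realType) m (u v : 'rV[R]_m * R) us y :
  minaff u (v :: us) y = Num.min (minaff u us y) (affv v y).
Proof.
apply/eqP; rewrite eq_le; apply/andP; split.
  rewrite le_min !le_minaff minaff_le ?inE ?eqxx ?orbT// andbT.
  by apply/allP => w; rewrite inE => wus; apply: minaff_le; rewrite !inE orbCA wus orbT.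
rewrite le_minaff; apply/allP => w; rewrite !inE orbCA => /orP[/eqP ->|wus].
  by rewrite ge_min lexx orbT.
by rewrite ge_min minaff_le.
Qed.

Lemma borel_minaff (R : realType) m (u : 'rV[R]_m * R) us : borel (minaff u us).
Proof.
elim: us u => [|v us IH] u; first exact: borel_affv.
move=> d T h mh.
have := measurable_minr (IH u d T h mh) (borel_affv v mh).
by congr measurable_fun; apply/funext => x /=; rewrite -minaff_cons.
Qed.

Lemma borel_set_lt_cst (R : realType) m (f : 'rV[R]_m -> R) b :
  borel f -> borel_set [set x | f x < b].
Proof. by move=> bf; apply: (borel_set_lt bf (borel_cst b)). Qed.

Lemma affv_convex (R : realType) m (u : 'rV[R]_m * R) x y t :
  affv u (t *: x + (1 - t) *: y) = t * affv u x + (1 - t) * affv u y.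
Proof. by rewrite /affv dotvDr !dotvZr; ring. Qed.

Lemma convex_body_setI (R : realType) m (M : R) (K A : set 'rV[R]_m) :
  convex_body M K -> borel_set A -> convex_set_rV A -> convex_body M (K `&` A).
Proof.
move=> [bK KM cK] bA cA; split; first exact: borel_setI.
- by move=> x [/KM].
- by move=> x y t [Kx Ax] [Ky Ay] t01; split; [exact: cK|exact: cA].
Qed.

Lemma convex_comb_sign (R : realType) (a b t : R) : 0 <= t <= 1 ->
  (0 < a -> 0 < b -> 0 < t * a + (1 - t) * b) /\
  (0 <= a -> 0 <= b -> 0 <= t * a + (1 - t) * b).
Proof.
move=> /andP[t0 t1]; split=> a0 b0; last by rewrite addr_ge0// mulr_ge0// subr_ge0.
have [->|tn0] := eqVneq t 0; first by rewrite mul0r add0r subr0 mul1r.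
by rewrite ltr_pwDl// ?mulr_gt0// ?lt0r ?tn0// mulr_ge0 ?subr_ge0// ltW.
Qed.

Lemma convex_affv_lt (R : realType) m (u v : 'rV[R]_m * R) :
  convex_set_rV [set y | affv u y < affv v y].
Proof.
move=> x y t /=; rewrite -![affv u _ < _]subr_gt0 => ux uy t01.
have := (convex_comb_sign _ _ t01).1 ux uy; rewrite !affv_convex; lra.
Qed.

Lemma convex_affv_le (R : realType) m (u v : 'rV[R]_m * R) :
  convex_set_rV [set y | affv u y <= affv v y].
Proof.
move=> x y t /=; rewrite -![affv u _ <= _]subr_ge0 => ux uy t01.
have := (convex_comb_sign _ _ t01).2 ux uy; rewrite !affv_convex; lra.
Qed.

Lemma indic_split (R : realType) T (K A B : set T) (x : T) :
  (A x -> ~ B x) -> (~ A x -> B x) -> \1_K x = \1_(K `&` A) x + \1_(K `&` B) x :> R.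
Proof.
move=> AB AB'; rewrite !indicI /= /indic.
have [Ax|nAx] := pselect (A x).
  by rewrite (mem_set Ax) (memNset (AB Ax)) mulr1 mulr0 addr0.
by rewrite (memNset nAx) (mem_set (AB' nAx)) mulr0 mulr1 add0r.
Qed.

(* Splitting [K] along the hyperplanes [u = v] keeps the pieces convex and ends with
   pieces on which the minimum is a single affine function; if that function is constant,
   the piece of [K] below [b] is empty. *)
Lemma minaff_oscillation (R : realType) m (M b : R) (u : 'rV[R]_m * R) us :
  0 <= M -> (forall w, w \in u :: us -> w.1 = 0 -> b <= w.2) ->
  exists2 C : R, 0 <= C & forall K, convex_body M K -> forall w p : R, 0 < w ->
    `|iint (fun y => \1_(K `&` [set y | minaff u us y < b]) y *
                     cos (w * minaff u us y + p))| <= C / w.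
Proof.
move=> M0; elim: us u => [|v us IH] u hb.
  have [u0|u0] := eqVneq u.1 0.
    exists 0 => // K bK w p w0; rewrite mul0r -(normr0 R) -(iint0 R m).
    rewrite le_eqVlt; apply/orP; left; apply/eqP; congr `|_|; apply: eq_iint => y.
    rewrite indicE memNset ?mul0r// => -[_] /=.
    by rewrite /affv u0 dotv0l add0r ltNge (hb u) ?mem_head.
  have [C C0 HC] := oscillation_bound u0 M0; exists C => // K bK w p w0.
  have bK' : convex_body M (K `&` [set y | affv u y < b]).
    apply: convex_body_setI => //; first by apply: borel_set_lt_cst; exact: borel_affv.
    have := convex_affv_lt (v := (0, b)) (u := u); congr convex_set_rV.
    by apply/seteqP; split => y /=; rewrite [affv (0, b) _]/affv dotv0l add0r.
  have := HC _ bK' w (w * u.2 + p) w0; congr (_ <= _); congr `|_|.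
  by apply: eq_iint => y; rewrite /= {3}/affv mulrDr addrA.
have [|Cu Cu0 HCu] := IH u.
  by move=> w wus; apply: hb; move: wus; rewrite !inE orbCA => ->; rewrite orbT.
have [|Cv Cv0 HCv] := IH v.
  by move=> w wus; apply: hb; rewrite inE wus orbT.
(* Both constants are fixed before [K] is known; they apply to the two pieces because these are
   convex bodies in the same cube. *)
exists (Cu + Cv); first exact: addr_ge0.
move=> K bK w p w0.
have nf (w0' : 'rV[R]_m * R) (ws : seq ('rV[R]_m * R)) (A : set 'rV[R]_m) : borel_set A ->
    nice (fun y => \1_((K `&` A) `&` [set y | minaff w0' ws y < b]) y *
                   cos (w * minaff w0' ws y + p)).
  move=> bA; have [bK' KM _] := bK.
  apply: (nice_indic_mul (M := M) (C := 1)).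
  - apply: borel_setI; first exact: borel_setI.
    by apply: borel_set_lt_cst; exact: borel_minaff.
  - by move=> x [[/KM]].
  - by apply: borel_cos_comp; exact: borel_minaff.
  - by move=> x; exact: cos_norm_le1.
pose A := [set y | affv u y <= affv v y]; pose B := [set y | affv v y < affv u y].
have bA : borel_set A by apply: borel_set_le; exact: borel_affv.
have bB : borel_set B by apply: borel_set_lt; exact: borel_affv.
have -> : iint (fun y => \1_(K `&` [set y | minaff u (v :: us) y < b]) y *
                     cos (w * minaff u (v :: us) y + p)) =
  iint (fun y => \1_((K `&` A) `&` [set y | minaff u us y < b]) y *
                     cos (w * minaff u us y + p)) +
  iint (fun y => \1_((K `&` B) `&` [set y | minaff v us y < b]) y *
                     cos (w * minaff v us y + p)).
  rewrite -iintD; [|exact: nf..]; apply: eq_iint => y.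
  rewrite !indicI /= /indic /A /B; have [uv|uv] := leP (affv u y) (affv v y).
    rewrite (@mem_set _ [set y | affv u y <= affv v y] y uv).
    rewrite (@memNset _ [set y | affv v y < affv u y]) /=; last by rewrite ltNge uv.
    rewrite mulr1 mulr0 !mul0r addr0; congr (_ * (_ _)%:R * _).
    by apply/idP/idP; rewrite !inE/= uv.
  rewrite (@memNset _ [set y | affv u y <= affv v y] y) /=; last by rewrite leNgt uv.
  rewrite (@mem_set _ [set y | affv v y < affv u y]) //.
  rewrite mulr1 mulr0 !mul0r add0r; congr (_ * (_ _)%:R * _).
  by apply/idP/idP; rewrite !inE/= leNgt uv.
rewrite (le_trans (ler_normD _ _))// mulrDl lerD//.
  by apply: HCu => //; apply: convex_body_setI => //; exact: convex_affv_le.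
by apply: HCv => //; apply: convex_body_setI => //; exact: convex_affv_lt.
Qed.

(** The set where the minimum equals [b] yields the explicit term and [minaff_oscillation] bounds
    the rest. The condition on constant rows holds as soon as the minimum reaches [b] somewhere. *)
Lemma minaff_stationary (R : realType) m (M b : R) (u : 'rV[R]_m * R) us :
  0 <= M -> (forall w, w \in u :: us -> w.1 = 0 -> b <= w.2) ->
  exists2 C : R, 0 <= C & forall K, convex_body M K ->
    (forall y, K y -> minaff u us y <= b) -> forall w p, 0 < w ->
    `|iint (fun y => \1_K y * cos (w * minaff u us y + p)) -
      vol (K `&` [set y | minaff u us y = b]) * cos (w * b + p)| <= C / w.
Proof.
move=> M0 hb; have [C C0 HC] := minaff_oscillation M0 hb; exists C => // K bK Kb w p w0.
have [bK' KM _] := bK.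
pose Q := K `&` [set y | b <= minaff u us y].
have QE : K `&` [set y | minaff u us y = b] = Q.
  apply/seteqP; split => y [Ky /= h]; split => //=; first by rewrite h.
  by apply/eqP; rewrite eq_le h Kb.
have bQ : borel_set Q.
  by apply: borel_setI => //; apply: (borel_set_le (borel_cst b)); exact: borel_minaff.
have nQ : nice (fun y => \1_Q y : R) by apply: (nice_indic (M := M)) => // x [/KM].
rewrite QE /vol mulrC -iintZ//.
have -> : iint (fun y => \1_K y * cos (w * minaff u us y + p)) =
  iint (fun y => cos (w * b + p) * \1_Q y) +
  iint (fun y => \1_(K `&` [set y | minaff u us y < b]) y * cos (w * minaff u us y + p)).
  rewrite -iintD.
  - apply: eq_iint => y; have [Ky|nKy] := pselect (K y); last first.
      by rewrite /Q !indicI /= /indic (memNset nKy) !mul0r mulr0 addr0.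
    rewrite (@indic_split R _ K [set y | b <= minaff u us y]
                         [set y | minaff u us y < b]) /=; last 2 first.
    + by move=> h; apply/negP; rewrite -leNgt.
    + by move=> /negP; rewrite -ltNge.
    rewrite mulrDl; congr (_ + _); rewrite mulrC indicE.
    case: (boolP (_ \in _)) => [|_]; last by rewrite !mulr0.
    rewrite inE => -[_ /= h]; congr (cos (_ * _ + _) * _).
    by apply/eqP; rewrite eq_le h Kb.
  - have : nice (fun y => \1_Q y * cos (w * b + p)).
      apply: (nice_indic_mul (M := M) (C := 1)) => //; first by move=> x [/KM].
        exact: borel_cst.
      by move=> _; exact: cos_norm_le1.
    by congr nice; apply/funext => x; rewrite mulrC.
  - apply: (nice_indic_mul (M := M) (C := 1)).
    + by apply: borel_setI => //; apply: borel_set_lt_cst; exact: borel_minaff.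
    + by move=> x [/KM].
    + by apply: borel_cos_comp; exact: borel_minaff.
    + by move=> x; exact: cos_norm_le1.
by rewrite addrC addKr; exact: HC.
Qed.

(** * Half-space representation and the asymptotics in adapted coordinates *)

Lemma dotvN (R : realType) n (c x : 'rV[R]_n) : dotv (- c) x = - dotv c x.
Proof. by rewrite dotvC -scaleN1r dotvZr mulN1r dotvC. Qed.

Lemma dotvZl (R : realType) n (c x : 'rV[R]_n) t : dotv (t *: c) x = t * dotv c x.
Proof. by rewrite dotvC dotvZr dotvC. Qed.

Lemma dotvDl (R : realType) n (c d x : 'rV[R]_n) : dotv (c + d) x = dotv c x + dotv d x.
Proof. by rewrite dotvC dotvDr ![dotv x _]dotvC. Qed.

(* Fourier-Motzkin elimination of [w]. *)
Lemma halfspaces_sweep (R : realType) n (L : seq 'rV[R]_n) (v : 'rV[R]_n) :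
  exists L' : seq 'rV[R]_n, forall z : 'rV[R]_n,
    (exists2 w : R, 0 <= w & {in L, forall a, dotv a (z - w *: v) <= 0}) <->
    {in L', forall a, dotv a z <= 0}.
Proof.
(* The constraint of a row is [dotv a z <= w * dotv a v]: a lower bound on [w] if [dotv a v > 0], an
   upper bound if negative. The kept rows compare the upper bounds with [w >= 0]; the combinations
   compare each lower with each upper bound. *)
exists ([seq a <- L | dotv a v <= 0] ++
  [seq dotv a v *: a' - dotv a' v *: a | a <- [seq a <- L | 0 < dotv a v],
                                         a' <- [seq a <- L | dotv a v < 0]]) => z.
have subE a w : (dotv a (z - w *: v) <= 0) = (dotv a z <= w * dotv a v).
  by rewrite -scaleNr dotvDr dotvZr mulNr subr_le0.
split.
  move=> [w w0 hw] a; rewrite mem_cat => /orP[|/allpairsP[[b b'] /= [+ + ->]]].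
    rewrite mem_filter => /andP[av aL].
    by have := hw a aL; rewrite subE => /le_trans; apply; rewrite mulr_ge0_le0.
  rewrite !mem_filter => /andP[bv bL] /andP[b'v b'L].
  have := hw b bL; have := hw b' b'L; rewrite !subE => h' h.
  rewrite dotvDl dotvN !dotvZl subr_le0.
  apply: (@le_trans _ _ (dotv b v * (w * dotv b' v))); first by rewrite ler_pM2l.
  rewrite (_ : _ * _ = dotv b' v * (w * dotv b v)); last by ring.
  by rewrite ler_nM2l.
move=> hL'.
(* The least admissible [w]: the maximum of 0 and all lower bounds. *)
exists (\big[Num.max/0]_(a <- L | 0 < dotv a v) (dotv a z / dotv a v)).
  exact: bigmax_ge_id.
move=> a aL; rewrite subE; set w := \big[_/_]_(_ <- _ | _) _.
have [av|av|av] := ltgtP (dotv a v) 0.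
- rewrite -ler_ndivlMr//; rewrite /w big_seq_cond; apply: bigmax_le.
    rewrite ler_ndivlMr// mul0r; apply: hL'.
    by rewrite mem_cat mem_filter ltW// aL.
  move=> b /andP[bL bv]; rewrite ler_ndivlMr// mulrAC ler_pdivlMr//.
  have /hL' : dotv b v *: a - dotv a v *: b \in [seq a <- L | dotv a v <= 0] ++
    [seq dotv a v *: a' - dotv a' v *: a | a <- [seq a <- L | 0 < dotv a v],
                                         a' <- [seq a <- L | dotv a v < 0]].
    rewrite mem_cat; apply/orP; right; apply/allpairsP; exists (b, a) => /=.
    by rewrite !mem_filter av aL bv bL.
  by rewrite dotvDl dotvN !dotvZl subr_le0 mulrC [dotv a v * _]mulrC.
- by rewrite -ler_pdivrMr//; apply: (@le_bigmax_seq _ _ _ _ _ a _ (fun a => dotv a z / dotv a v)).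
- by rewrite av mulr0; apply: hL'; rewrite mem_cat mem_filter av lexx aL.
Qed.

(** Induction on the number of generators: adding one sweeps the cone along it. The cone without
    generators is the origin, cut out by the coordinate vectors and their opposites. *)
Lemma cone_halfspaces (R : realType) n k (V : 'I_k -> 'rV[R]_n) :
  exists L : seq 'rV[R]_n, forall z : 'rV[R]_n,
    (exists2 w : 'I_k -> R, forall j, 0 <= w j & z = \sum_j w j *: V j) <->
    {in L, forall a, dotv a z <= 0}.
Proof.
elim: k V => [|k IH] V.
  exists ([seq delta_mx ord0 i | i : 'I_n] ++ [seq - delta_mx ord0 i | i : 'I_n]) => z.
  have dE i : dotv (delta_mx ord0 i) z = z ord0 i.
    rewrite /dotv (bigD1 i)//= big1 ?addr0; first by rewrite mxE !eqxx mul1r.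
    by move=> j ji; rewrite mxE eqxx /= (negbTE ji) mul0r.
  split.
    move=> [w _ ->] a; rewrite big_ord0 => _.
    by rewrite /dotv big1// => i _; rewrite mxE mulr0.
  move=> h; exists (fun=> 0); first by case.
  rewrite big_ord0; apply/rowP => i; rewrite [RHS]mxE; apply/eqP; rewrite eq_le; apply/andP; split.
    rewrite -dE; apply: h; rewrite mem_cat; apply/orP; left.
    by apply/mapP; exists i; rewrite ?mem_enum.
  rewrite -oppr_le0 -dE -dotvN; apply: h; rewrite mem_cat; apply/orP; right.
  by apply/mapP; exists i; rewrite ?mem_enum.
have [L HL] := IH (fun j => V (lift ord0 j)).
have [L' HL'] := halfspaces_sweep L (V ord0).
exists L' => z; rewrite -HL'; split.
  move=> [w w0 ->]; exists (w ord0) => //; apply/HL; exists (fun j => w (lift ord0 j)) => //.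
  by rewrite big_ord_recl addrC addKr.
move=> [t t0 /HL[w w0 E]].
exists (fun j => if unlift ord0 j is Some j' then w j' else t).
  by move=> j; case: unliftP.
rewrite big_ord_recl unlift_none; under eq_bigr do rewrite liftK.
by rewrite -E addrC subrK.
Qed.

Definition polyhedron (R : realType) n (L : seq ('rV[R]_n * R)) : set 'rV[R]_n :=
  [set x | {in L, forall c, dotv c.1 x <= c.2}].

Lemma scons_sum (R : realType) n k (w : 'I_k -> R) (V : 'I_k -> 'rV[R]_n) :
  \sum_j w j *: scons 1 (V j) = scons (\sum_j w j) (\sum_j w j *: V j).
Proof.
apply: (big_ind3 (fun x a b => x = scons a b)).
- by have := scons_scale 0 0 (0 : 'rV[R]_n); rewrite mul0r scaler0 scale0r => ->.
- by move=> x1 a1 b1 x2 a2 b2 -> ->; rewrite scons_add.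
- by move=> j _; rewrite scons_scale mulr1.
Qed.

Lemma scons_inj (R : realType) n (t u : R) (x y : 'rV[R]_n) :
  scons t x = scons u y -> t = u /\ x = y.
Proof.
by move=> E; rewrite -(stailK t x) E stailK -(scons_head t x) E scons_head.
Qed.

(** Homogenization: [x] is in the hull exactly when (1, x) is in the cone over the points (1, V_j);
    the first coordinate of a linear inequality of the cone becomes the constant of an affine
    one. *)
Lemma hull_polyhedron (R : realType) n k (V : 'I_k -> 'rV[R]_n) :
  exists L, [set x | exists w : 'I_k -> R, (forall j, 0 <= w j) /\
               \sum_(j < k) w j = 1 /\ x = \sum_(j < k) w j *: V j] = polyhedron L.
Proof.
have [L HL] := cone_halfspaces (fun j => scons 1 (V j)).
exists [seq (stail a, - a ord0 ord0) | a <- L].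
have aE a x : (dotv a (scons 1 x) <= 0) = (dotv (stail a) x <= - a ord0 ord0).
  by rewrite dotv_scons mulr1 addrC -lerBrDr sub0r.
apply/seteqP; split => x.
  move=> [w [w0 [w1 ->]]] _ /mapP[a aL ->] /=; rewrite -aE.
  by apply: (HL _).1 => //; exists w => //; rewrite scons_sum w1.
move=> hx; have /HL[w w0] : {in L, forall a, dotv a (scons 1 x) <= 0}.
  by move=> a aL; rewrite aE; apply: (hx (stail a, - a ord0 ord0)); apply/mapP; exists a.
by rewrite scons_sum => /scons_inj[w1 xE]; exists w.
Qed.

Lemma borel_polyhedron (R : realType) n (L : seq ('rV[R]_n * R)) : borel_set (polyhedron L).
Proof.
elim: L => [|c L IH].
  have := borel_cst (n := n) (1 : R); congr borel; apply/funext => x.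
  by rewrite indicE mem_set.
have -> : polyhedron (c :: L) = [set x | dotv c.1 x <= c.2] `&` polyhedron L.
  apply/seteqP; split => x /=.
    by move=> h; split; [apply: h; rewrite mem_head|move=> d dL; apply: h; rewrite inE dL orbT].
  by move=> [h1 h2] d; rewrite inE => /orP[/eqP ->|/h2].
by apply: borel_setI => //; apply: (borel_set_le (borel_dotv _) (borel_cst _)).
Qed.

Lemma convex_polyhedron (R : realType) n (L : seq ('rV[R]_n * R)) :
  convex_set_rV (polyhedron L).
Proof.
move=> x y t hx hy t01 c cL; rewrite dotvDr !dotvZr.
have hx' : 0 <= c.2 - dotv c.1 x by rewrite subr_ge0; exact: hx.
have hy' : 0 <= c.2 - dotv c.1 y by rewrite subr_ge0; exact: hy.
have := (convex_comb_sign _ _ t01).2 hx' hy'; lra.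
Qed.

Lemma niceD (R : realType) n (f g : 'rV[R]_n -> R) :
  nice f -> nice g -> nice (fun x => f x + g x).
Proof.
move=> [bf [K fK]] [bg [K' gK]]; split; first exact: borelD.
have K0 : 0 <= K by apply: le_trans (fK 0).1.
have K0' : 0 <= K' by apply: le_trans (gK 0).1.
exists (K + K') => x; split.
  by rewrite (le_trans (ler_normD _ _))// lerD ?(fK x).1 ?(gK x).1.
move=> fg i; have [f0|/(fK x).2/(_ i) xK] := eqVneq (f x) 0.
  move: fg; rewrite f0 add0r => /(gK x).2/(_ i) xK.
  by rewrite (le_trans xK)// lerDr.
by rewrite (le_trans xK)// lerDl.
Qed.

(** * Sections of a polyhedron along the first coordinate *)

Definition upper_rows (R : realType) m (L : seq ('rV[R]_m.+1 * R)) : seq ('rV[R]_m * R) :=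
  [seq (- (c.1 ord0 ord0)^-1 *: stail c.1, c.2 / c.1 ord0 ord0) |
    c : 'rV[R]_m.+1 * R <- L & 0 < c.1 ord0 ord0].

(* [t] is bounded below by the negatives of these affine functions. *)
Definition lower_rows (R : realType) m (L : seq ('rV[R]_m.+1 * R)) : seq ('rV[R]_m * R) :=
  [seq ((c.1 ord0 ord0)^-1 *: stail c.1, - (c.2 / c.1 ord0 ord0)) |
    c : 'rV[R]_m.+1 * R <- L & c.1 ord0 ord0 < 0].

Definition level_rows (R : realType) m (L : seq ('rV[R]_m.+1 * R)) : seq ('rV[R]_m * R) :=
  [seq (stail c.1, c.2) | c : 'rV[R]_m.+1 * R <- L & c.1 ord0 ord0 == 0].

Lemma polyhedron_scons (R : realType) m (L : seq ('rV[R]_m.+1 * R)) t y :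
  polyhedron L (scons t y) <->
  [/\ polyhedron (level_rows L) y, all (fun u => t <= affv u y) (upper_rows L) &
      all (fun u => - t <= affv u y) (lower_rows L)].
Proof.
split.
  move=> h; split.
  - move=> _ /mapP[c + ->] /=; rewrite mem_filter => /andP[/eqP c0 cL].
    by have := h c cL; rewrite dotv_scons c0 mul0r add0r.
  - apply/allP => _ /mapP[c + ->]; rewrite mem_filter => /andP[c0 cL].
    have := h c cL; rewrite dotv_scons /affv/= dotvZl => hc.
    rewrite mulNr addrC -[X in - X]mulrC -mulrBl ler_pdivlMr// mulrC; lra.
  - apply/allP => _ /mapP[c + ->]; rewrite mem_filter => /andP[c0 cL].
    have := h c cL; rewrite dotv_scons /affv/= dotvZl => hc.
    rewrite -[X in X - _]mulrC -mulrBl ler_ndivlMr// mulNr mulrC; lra.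
move=> [h0 hu hl] c cL; rewrite dotv_scons.
have [c0|c0|c0] := ltgtP (c.1 ord0 ord0) 0.
- have mc : ((c.1 ord0 ord0)^-1 *: stail c.1, - (c.2 / c.1 ord0 ord0)) \in lower_rows L.
    by apply/mapP; exists c; rewrite ?mem_filter ?c0.
  move/allP: hl => /(_ _ mc).
  rewrite /affv/= dotvZl -[X in X - _]mulrC -mulrBl ler_ndivlMr// mulNr; lra.
- have mc : (- (c.1 ord0 ord0)^-1 *: stail c.1, c.2 / c.1 ord0 ord0) \in upper_rows L.
    by apply/mapP; exists c; rewrite ?mem_filter ?c0.
  move/allP: hu => /(_ _ mc).
  rewrite /affv/= dotvZl mulNr addrC -[X in - X]mulrC -mulrBl ler_pdivlMr//; lra.
- rewrite c0 mul0r add0r; apply: (h0 (stail c.1, c.2)).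
  by apply/mapP; exists c; rewrite ?mem_filter ?c0 ?eqxx.
Qed.

(** The sines of the primitive are written as cosines shifted by pi / 2, with [- l] in place of [l]:
    both boundary terms then have the form treated by [minaff_stationary], for the upper function
    [h] and the lower function [g]. *)
Lemma Rintegral_indic_itv_cos (R : realType) (l h w p : R) : w != 0 -> l <= h ->
  \int[@lebesgue_measure R]_t (\1_(`[l, h]%classic : set R) t * cos (- (w * t) + p)) =
  w^-1 * (cos (w * h + (- p - pi / 2)) + cos (w * - l + (p - pi / 2))).
Proof.
move=> w0 lh.
have := integral_cos_affine p (l := l) (h := h) (w := - w); rewrite oppr_eq0 => /(_ w0 lh).
rewrite Rintegral_mkcond => E.
apply: (eq_trans (eq_trans _ E)).
  apply: eq_Rintegral => t _; rewrite patchE indicE -mulNr.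
  by case: ifPn; rewrite ?mul1r ?mul0r.
rewrite !addrA !cosBpihalf invrN mulNr -mulrN; congr (_ * _).
by rewrite opprB [RHS]addrC mulrN -sinN; congr (sin _ + sin _); ring.
Qed.

(** The inner integral contributes a factor 1 / w, which turns the O(1 / w) errors of
    [minaff_stationary] for [h] at level [b] and [g] at level [- a] into O(1 / w^2). *)
Theorem polyhedron_asymptotics (R : realType) m (L : seq ('rV[R]_m.+1 * R)) (M a b th : R) :
  let P := polyhedron L in
  (forall x, P x -> forall i, `|x ord0 i| <= M) ->
  (forall x, P x -> a <= x ord0 ord0 <= b) ->
  (exists2 x, P x & x ord0 ord0 = a) -> (exists2 x, P x & x ord0 ord0 = b) ->
  exists2 C : R, 0 <= C & forall w : R, 0 < w ->
    `|iint (fun x => \1_P x * cos (- (w * x ord0 ord0) + th)) -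
      w^-1 * (vol [set y | P (scons b y)] * sin (w * b - th) -
              vol [set y | P (scons a y)] * sin (w * a - th))| <= C / w ^+ 2.
Proof.
move=> P PM Pab [xa Pxa xaE] [xb Pxb xbE].
have M0 : 0 <= M by apply: le_trans (PM _ Pxa ord0).
have PS t y : P (scons t y) <-> _ := polyhedron_scons L t y.
have Pxa' := Pxa; rewrite -(scons_stail xa) xaE in Pxa'.
have Pxb' := Pxb; rewrite -(scons_stail xb) xbE in Pxb'.
(* Without a row bounding the first coordinate from above, [xa] could be raised to a point of [P]
   with first coordinate above [M]; the lower rows are treated symmetrically. *)
case EU : (upper_rows L) => [|u us].
  have : P (scons (Num.max a (M + 1)) (stail xa)).
    have /PS[h1 h2 h3] := Pxa'; apply/PS; rewrite EU; split => //.
    apply/allP => v /(allP h3); apply: le_trans.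
    by rewrite lerN2 le_max lexx.
  move=> /PM/(_ ord0); rewrite scons_head => /(le_trans (ler_norm _)).
  by rewrite ge_max => /andP[_]; rewrite gerDl ler10.
case EN : (lower_rows L) => [|v vs].
  have : P (scons (Num.min a (- (M + 1))) (stail xa)).
    have /PS[h1 h2 h3] := Pxa'; apply/PS; rewrite EN; split => //.
    apply/allP => u' /(allP h2); apply: le_trans.
    by rewrite ge_min lexx.
  move=> /PM/(_ ord0); rewrite scons_head ler_norml => /andP[+ _].
  by rewrite le_min => /andP[_]; rewrite lerN2 gerDl ler10.
pose h := minaff u us; pose g := minaff v vs.
have PE t y : P (scons t y) <-> polyhedron (level_rows L) y /\ - g y <= t <= h y.
  rewrite PS EU EN -!le_minaff lerNl; split; first by move=> [? -> ->].
  by move=> [? /andP[]].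
pose K := [set y | polyhedron (level_rows L) y /\ - g y <= h y].
have KP y : K y -> P (scons (h y) y) /\ P (scons (- g y) y).
  by move=> [Zy gh]; split; apply/PE; rewrite gh lexx.
have PK t y : P (scons t y) -> K y.
  by move=> /PE[Zy /andP[yt ty]]; split => //; exact: le_trans ty.
(* Borel measurability is read off the inequalities in [g] and [h], convexity off [K] being the
   projection of a convex set. *)
have bK : convex_body M K.
  split.
  - apply: borel_setI; first exact: borel_polyhedron.
    apply: borel_set_le; last exact: borel_minaff.
    by apply: (borel_comp (g := -%R)) => //; exact: borel_minaff.
  - move=> y /KP[/PM yM _] i; have := yM (lift ord0 i); by rewrite scons_lift.
  - move=> x y t /KP[Px _] /KP[Py _] t01.
    have := convex_polyhedron Px Py t01; rewrite !scons_scale scons_add; exact: PK.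
have hb y : K y -> h y <= b by move=> /KP[/Pab/andP[_ +] _]; rewrite scons_head.
have ga y : K y -> g y <= - a.
  by move=> /KP[_ /Pab/andP[+ _]]; rewrite scons_head lerNr.
(* A constant row lies above the minimum [h], and [h] reaches [b] over the maximizer [xb]. *)
have cb u' : u' \in u :: us -> u'.1 = 0 -> b <= u'.2.
  move=> uus u0; have /PE[_ /andP[_ hx]] := Pxb'.
  by have := le_trans hx (minaff_le _ uus); rewrite /affv u0 dotv0l add0r.
have ca v' : v' \in v :: vs -> v'.1 = 0 -> - a <= v'.2.
  move=> vvs v0; have /PE[_ /andP[+ _]] := Pxa'; rewrite lerNl => gx.
  by have := le_trans gx (minaff_le _ vvs); rewrite /affv v0 dotv0l add0r.
have [C1 C10 HC1] := minaff_stationary M0 cb.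
have [C2 C20 HC2] := minaff_stationary M0 ca.
exists (C1 + C2); first exact: addr_ge0.
move=> w w0.
have nK (k : 'rV[R]_m -> R) p : borel k -> nice (fun y => \1_K y * cos (w * k y + p)).
  move=> bk; have [bK' KM _] := bK.
  apply: (nice_indic_mul (C := 1) bK' KM); first exact: borel_cos_comp.
  by move=> x; exact: cos_norm_le1.
have bh : borel h by exact: borel_minaff.
have bg : borel g by exact: borel_minaff.
have -> : iint (fun x => \1_P x * cos (- (w * x ord0 ord0) + th)) =
  w^-1 * (iint (fun y => \1_K y * cos (w * h y + (- th - pi / 2))) +
          iint (fun y => \1_K y * cos (w * g y + (th - pi / 2)))).
  rewrite iint_swap; last first.
    apply: (nice_indic_mul (C := 1) (borel_polyhedron L) PM).
      have be : borel (fun x : 'rV[R]_m.+1 => x ord0 ord0) by move=> d T k mk; exact: mk.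
      have := borel_cos_comp (- w) th be; congr borel; apply/funext => x.
      by rewrite mulNr.
    by move=> x; exact: cos_norm_le1.
  rewrite -iintD; [|exact: nK..].
  have nKK : nice (fun x => \1_K x * cos (w * h x + (- th - pi / 2)) +
                   \1_K x * cos (w * g x + (th - pi / 2))).
    by apply: niceD; exact: nK.
  rewrite -iintZ//; apply: eq_iint => y.
  have [Ky|nKy] := pselect (K y); last first.
    rewrite !indicE (memNset nKy) !mul0r addr0 mulr0.
    rewrite (_ : (fun t => _) = cst 0) ?Rintegral_cst ?mul0r//.
    apply/funext => t /=; rewrite indicE memNset ?mul0r//.
    by move=> /PK.
  rewrite !indicE (mem_set Ky) !mul1r.
  have [Zy gh] := Ky.
  have wn0 : w != 0 by rewrite gt_eqF.
  have := Rintegral_indic_itv_cos th wn0 gh; rewrite opprK => <-.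
  apply: eq_Rintegral => t _; rewrite scons_head !indicE; congr ((nat_of_bool _)%:R * _).
  apply/idP/idP; rewrite !inE/= in_itv/=.
    by move=> /PE[].
  by move=> gth; apply/PE.
have VE : vol [set y | P (scons b y)] = vol (K `&` [set y | h y = b]).
  congr vol; apply/seteqP; split => y /=.
    move=> Pby; have Ky := PK _ _ Pby; split => //=.
    have /PE[_ /andP[_ bh']] := Pby; by apply/eqP; rewrite eq_le hb.
  by move=> [Ky /= <-]; have [] := KP _ Ky.
have VE' : vol [set y | P (scons a y)] = vol (K `&` [set y | g y = - a]).
  congr vol; apply/seteqP; split => y /=.
    move=> Pay; have Ky := PK _ _ Pay; split => //=.
    have /PE[_ /andP[+ _]] := Pay; rewrite lerNl => ag; by apply/eqP; rewrite eq_le ga.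
  move=> [Ky /= gy]; have [_] := KP _ Ky; by rewrite gy opprK.
rewrite VE VE' -mulrBr normrM gtr0_norm ?invr_gt0//.
rewrite (_ : (C1 + C2) / w ^+ 2 = w^-1 * ((C1 + C2) / w)); last first.
  by field; rewrite gt_eqF.
rewrite ler_wpM2l ?invr_ge0 ?(ltW w0)//.
have := HC1 _ bK hb w (- th - pi / 2) w0; have := HC2 _ bK ga w (th - pi / 2) w0.
rewrite !addrA !cosBpihalf -/h -/g => H2 H1.
have E : sin (w * - a + th) = - sin (w * a - th).
  by rewrite -sinN; congr sin; ring.
rewrite E mulrN opprK in H2.
have H := lerD H1 H2; rewrite -mulrDl in H; apply: le_trans H; apply: le_trans (ler_normD _ _).
by rewrite le_eqVlt; apply/orP; left; apply/eqP; congr `|_|; ring.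
Qed.

(** * Facets orthogonal to a direction *)

Lemma dotv_mx (R : realType) n (x y : 'rV[R]_n) : dotv x y = (x *m y^T) ord0 ord0.
Proof. by rewrite mxE; apply: eq_bigr => i _; rewrite mxE. Qed.

Lemma mulmx_trE (R : realType) n (x y : 'rV[R]_n) : x *m y^T = (dotv x y)%:M.
Proof. by rewrite dotv_mx -mx11_scalar. Qed.

Lemma dotv_ge0 (R : realType) n (x : 'rV[R]_n) : 0 <= dotv x x.
Proof. by apply: sumr_ge0 => i _; rewrite -expr2 sqr_ge0. Qed.

Lemma dotv_eq0 (R : realType) n (x : 'rV[R]_n) : (dotv x x == 0) = (x == 0).
Proof.
apply/idP/eqP => [|->]; last by rewrite dotv0l.
rewrite psumr_eq0 => [/allP h|i _]; last by rewrite -expr2 sqr_ge0.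
apply/rowP => i; rewrite mxE; apply/eqP.
by have := h i (mem_index_enum _); rewrite mulf_eq0 orbb.
Qed.

Lemma sqr_normv (R : realType) n (x : 'rV[R]_n) : normv x ^+ 2 = dotv x x.
Proof. by rewrite sqr_sqrtr// dotv_ge0. Qed.

Lemma dotvBr (R : realType) n (c x y : 'rV[R]_n) : dotv c (x - y) = dotv c x - dotv c y.
Proof. by rewrite dotvDr -scaleN1r dotvZr mulN1r. Qed.

Lemma dotv_mul (R : realType) m n (c : 'rV[R]_n) (y : 'rV[R]_m) (A : 'M[R]_(m, n)) :
  dotv c (y *m A) = dotv (c *m A^T) y.
Proof. by rewrite !dotv_mx trmx_mul mulmxA. Qed.

(** * Orthonormal frames and slices orthogonal to a unit vector *)

Definition orthonormal_frame (R : realType) m (u : 'rV[R]_m.+1) (B : 'M[R]_(m, m.+1)) : Prop :=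
  [/\ dotv u u = 1, B *m B^T = 1%:M & B *m u^T = 0].

(** The orthogonal change of coordinates sending (t, y) to [t *: u + y *m B]. *)
Definition frame_mx (R : realType) m (u : 'rV[R]_m.+1) (B : 'M[R]_(m, m.+1)) : 'M[R]_m.+1 :=
  col_mx u B.

Lemma frame_mx_orthogonal (R : realType) m (u : 'rV[R]_m.+1) B :
  orthonormal_frame u B -> frame_mx u B *m (frame_mx u B)^T = 1%:M.
Proof.
move=> [uu BB Bu]; rewrite /frame_mx (@tr_col_mx _ 1 m) (@mul_col_row _ 1 m _ 1 m).
have uB : u *m B^T = 0 by rewrite -[LHS]trmxK trmx_mul trmxK Bu trmx0.
rewrite mulmx_trE uu BB Bu uB.
by rewrite -scalar_mx_block.
Qed.

Lemma scons_col_mx (R : realType) k n (x : 'rV[R]_n) (N : 'M[R]_(k, n)) t y :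
  scons t y *m (col_mx x N : 'M[R]_(k.+1, n)) = t *: x + y *m N.
Proof. by rewrite /scons (@mul_row_col _ 1 1 k) const_mx1 mul_scalar_mx. Qed.

Lemma scons00 (R : realType) m : scons 0 (0 : 'rV[R]_m) = 0.
Proof. by have := scons_scale 0 0 (0 : 'rV[R]_m); rewrite mul0r scaler0 scale0r. Qed.

Lemma scons_frame (R : realType) m (u : 'rV[R]_m.+1) B t y :
  scons t y *m frame_mx u B = t *: u + y *m B.
Proof. exact: scons_col_mx. Qed.

Lemma frame_decomp (R : realType) m (u : 'rV[R]_m.+1) B k (x : 'M[R]_(k, m.+1)) :
  orthonormal_frame u B -> x = (x *m u^T) *m u + (x *m B^T) *m B.
Proof.
move=> /frame_mx_orthogonal/mulmx1C QQ.
rewrite -[LHS]mulmx1 -QQ /frame_mx (@tr_col_mx _ 1 m) (@mul_row_col _ _ 1 m).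
by rewrite mulmxDr !mulmxA.
Qed.

(* Householder: the reflection exchanging [e_0] and [u]; when [u = e_0] the coefficient [2
   / 0 = 0] gives the identity. *)
Lemma orthonormal_frame_exists (R : realType) m (u : 'rV[R]_m.+1) :
  dotv u u = 1 -> exists B, orthonormal_frame u B.
Proof.
move=> uu; pose e : 'rV[R]_m.+1 := delta_mx ord0 ord0.
pose v := e - u; pose k := 2 / dotv v v.
pose Q : 'M[R]_m.+1 := 1%:M - k *: (v^T *m v).
have ee : dotv e e = 1.
  rewrite /dotv (bigD1 ord0)//= big1 ?addr0; first by rewrite mxE !eqxx mulr1.
  by move=> j j0; rewrite mxE eqxx /= (negbTE j0) mul0r.
have QT : Q^T = Q by rewrite /Q linearB/= trmx1 linearZ/= trmx_mul trmxK.
have kk : k * (k * dotv v v) = k + k.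
  rewrite /k; have [->|v0] := eqVneq (dotv v v) 0; first by rewrite invr0 !mulr0 addr0.
  by field.
have QQ : Q *m Q^T = 1%:M.
  rewrite QT {2}/Q mulmxBr mulmx1 -scalemxAr /Q mulmxBl mul1mx -scalemxAl.
  rewrite -!mulmxA (mulmxA v) mulmx_trE mul_scalar_mx -scalemxAr scalerBr !scalerA.
  by rewrite -mulrA kk scalerDl opprB addrK subrK.
have eQ : e *m Q = u.
  rewrite /Q mulmxBr mulmx1 -scalemxAr mulmxA mulmx_trE mul_scalar_mx scalerA.
  (* Since [e] and [u] are unit vectors, |v|^2 = 2 (e . v); hence k (e . v) = 1 and [e] is sent to e
     - v = u. *)
  have vv : dotv v v = 2 * dotv e v.
    have ev : dotv e v = 1 - dotv e u by rewrite dotvBr ee.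
    have uv : dotv u v = dotv e u - 1 by rewrite dotvBr uu dotvC.
    rewrite {2}/v dotvBr [dotv v e]dotvC [dotv v u]dotvC ev uv; ring.
  have [v0|v0] := eqVneq v 0.
    by rewrite v0 scaler0 subr0; apply/eqP; rewrite -subr_eq0 -/v v0.
  have -> : k * dotv e v = 1.
    rewrite /k vv; have : dotv e v != 0.
      by move: v0; rewrite -dotv_eq0 vv mulf_eq0 negb_or => /andP[].
    by move=> ?; field.
  by rewrite scale1r /v opprB addrC subrK.
pose B : 'M[R]_(m, m.+1) := @dsubmx _ 1 m _ Q.
have QE : Q = col_mx u B.
  rewrite -[LHS](@vsubmxK _ 1 m); congr (@col_mx _ 1 m _ _ _).
  apply/rowP => j; rewrite -eQ -rowE [LHS]mxE [RHS]mxE.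
  by congr fun_of_matrix; exact: val_inj.
exists B; move: QQ; rewrite QE (@tr_col_mx _ 1 m) (@mul_col_row _ 1 m _ 1 m).
rewrite (@scalar_mx_block _ 1 m) => /(@eq_block_mx _ 1 m 1 m)[_ _ Bu BB].
by split.
Qed.

Lemma frame_face_difference (R : realType) m (u : 'rV[R]_m.+1) B (x : 'rV[R]_m.+1) :
  orthonormal_frame u B -> dotv u x = 0 -> x = (x *m B^T) *m B.
Proof.
move=> fB ux; rewrite {1}(frame_decomp x fB) mulmx_trE dotvC ux.
by rewrite raddf0 mul0mx add0r.
Qed.

Lemma dotv_frame (R : realType) m (u : 'rV[R]_m.+1) B y :
  orthonormal_frame u B -> dotv u (y *m B) = 0.
Proof. by move=> [_ _ Bu]; rewrite dotvC dotv_mx -mulmxA Bu mulmx0 mxE. Qed.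

Definition bounded_rV (R : realType) n (M : R) (P : set 'rV[R]_n) : Prop :=
  forall x, P x -> forall i, `|x ord0 i| <= M.

Lemma slice_nice (R : realType) m (u : 'rV[R]_m.+1) B (L : seq ('rV[R]_m.+1 * R)) M p :
  orthonormal_frame u B -> bounded_rV M (polyhedron L) ->
  exists M', convex_body M' [set y | polyhedron L (p + y *m B)].
Proof.
move=> fB PM; have [uu BB Bu] := fB.
have M0 : 0 <= `|M| + \sum_i `|p ord0 i| by rewrite addr_ge0// sumr_ge0.
have [C _ CB] := mulmx_bounded (B^T) M0.
exists C; split.
- have := @borel_mulmx R m m.+1 _ B p (borel_polyhedron L); congr borel.
  by apply/funext => y; rewrite !indicE addrC.
- move=> y /= /PM yM i; rewrite -[y]mulmx1 -BB mulmxA; apply: CB => j.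
  have -> : (y *m B) ord0 j = (p + y *m B) ord0 j - p ord0 j.
    by rewrite [in RHS]mxE addrC addKr.
  rewrite (le_trans (ler_normB _ _))// lerD//; first exact: le_trans (yM j) (ler_norm _).
  by rewrite (bigD1 j)//= lerDl sumr_ge0.
- move=> x y t /= Px Py t01; have := convex_polyhedron Px Py t01; congr polyhedron.
  rewrite mulmxDl -!scalemxAl !scalerDr addrACA -scalerDl.
  by rewrite [t + _]addrC subrK scale1r.
Qed.

(** The two parametrizations of the same hyperplane differ by the rigid motion y -> y O + v, with
    [O = B1 *m B2^T] orthogonal. *)
Lemma slice_vol_eq (R : realType) m (u : 'rV[R]_m.+1) B1 B2 (L : seq ('rV[R]_m.+1 * R)) M p1 p2 :
  orthonormal_frame u B1 -> orthonormal_frame u B2 -> bounded_rV M (polyhedron L) ->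
  dotv u p1 = dotv u p2 ->
  vol [set y | polyhedron L (p1 + y *m B1)] = vol [set y | polyhedron L (p2 + y *m B2)].
Proof.
move=> f1 f2 PM up; have [uu BB1 Bu1] := f1.
have [M' [bA AM _]] := slice_nice p2 f2 PM.
have nA := nice_indic bA AM; set A := [set y | polyhedron L (p2 + y *m B2)] in nA *.
pose O := B1 *m B2^T; pose v := (p1 - p2) *m B2^T.
have OB : O *m B2 = B1.
  by rewrite [RHS](frame_decomp B1 f2) Bu1 mul0mx add0r.
have OO : O *m O^T = 1%:M by rewrite {2}/O trmx_mul trmxK mulmxA OB.
have vB : v *m B2 = p1 - p2.
  by rewrite -(frame_face_difference f2)// dotvBr up subrr.
rewrite /vol -(iint_translate v nA) -(iint_orthogonal OO (nice_shift v nA)).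
apply: eq_iint => y.
have E : p2 + (y *m O + v) *m B2 = p1 + y *m B1.
  by rewrite mulmxDl vB -mulmxA OB addrCA [p2 + _]addrC subrK addrC.
by rewrite !indicE; congr (nat_of_bool _)%:R; apply/idP/idP; rewrite !inE /A/= E.
Qed.

(** With the shift [- (w * d)] the cosine is identically 1 on [D], so the oscillation bound reads
    [|vol D| <= C / w] for every [w > 0]. *)
Lemma vol_hyperplane (R : realType) m (M : R) (c : 'rV[R]_m) d (D : set 'rV[R]_m) :
  c != 0 -> convex_body M D -> (forall z, D z -> dotv c z = d) -> vol D = 0.
Proof.
move=> c0 bD cD; have [bD' DM _] := bD.
have [->|/set0P[z0 Dz0]] := eqVneq D set0.
  by rewrite /vol -[RHS](iint0 R m); apply: eq_iint => y; rewrite indic0.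
have M0 : 0 <= M.
  have [i _] : exists i, c ord0 i != 0 by apply/existsP; apply: contraR c0;
    rewrite negb_exists => /forallP h; apply/eqP/rowP => i; rewrite mxE; apply/eqP;
    have := h i; rewrite negbK.
  exact: le_trans (DM _ Dz0 i).
have [C C0 HC] := oscillation_bound c0 M0.
have VC w : 0 < w -> `|vol D| <= C / w.
  move=> w0; have := HC D bD w (- (w * d)) w0; congr (`| _ | <= _).
  apply: eq_iint => y; rewrite indicE; case: (boolP (_ \in _)) => [|_]; last by rewrite mul0r.
  by rewrite inE => /cD ->; rewrite addrN cos0 mulr1.
apply/eqP; rewrite -normr_le0; apply/ler_addgt0Pl => e e0; rewrite addr0.
(* This [w] gives [C / w <= e]; the added 1 keeps it positive when [C = 0]. *)
apply: le_trans (VC ((C + 1) / e) _) _; first by rewrite divr_gt0// ltr_pwDr.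
by rewrite invfM invrK mulrA ler_piMl ?(ltW e0)// ler_pdivrMr ?ltr_pwDr// mul1r lerDl.
Qed.

(** Greedy choice: take [c] orthogonal to the directions found so far; a point of [D] off the
    hyperplane through [z0] with normal [c] gives a new independent direction. *)
Lemma affinely_independent_points (R : realType) m (D : set 'rV[R]_m) z0 :
  (forall c, c != 0 -> exists2 z, D z & dotv c (z - z0) != 0) ->
  forall k, (k <= m)%N -> exists N : 'M[R]_(k, m),
    row_free N /\ forall i, D (z0 + row i N).
Proof.
move=> Dspan; elim=> [|k IH] km.
  by exists 0; split; [rewrite /row_free mxrank0|case].
have [N [rN DN]] := IH (ltnW km).
(* The rank of [N] is [k < m], so the kernel of [N^T] has a nonzero row. *)
have [c c0 cN] : exists2 c : 'rV[R]_m, c != 0 & c *m N^T = 0.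
  have K0 : kermx N^T != 0.
    by rewrite -mxrank_eq0 mxrank_ker mxrank_tr (eqP rN) -lt0n subn_gt0.
  have [i ri] : exists i, row i (kermx N^T) != 0.
    by apply/existsP; apply: contraR K0; rewrite negb_exists => /forallP h;
      apply/eqP/row_matrixP => i; rewrite row0; apply/eqP; have := h i; rewrite negbK.
  by exists (row i (kermx N^T)) => //; rewrite -row_mul mulmx_ker row0.
have [z Dz cz] := Dspan c c0.
exists (col_mx (z - z0) N : 'M[R]_(1 + k, m)); split.
  apply: inj_row_free => v.
  rewrite -[v]scons_stail scons_col_mx; move: (v ord0 ord0) (stail v) => t y E.
  have t0 : t = 0.
    have := congr1 (dotv c) E.
    rewrite dotvDr dotvZr dotv_mul cN dotv0l addr0.
    rewrite (_ : dotv c 0 = 0); last by rewrite dotvC dotv0l.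
    by move/eqP; rewrite mulf_eq0 (negbTE cz) orbF => /eqP.
  move: E; rewrite t0 scale0r add0r => /eqP; rewrite (mulmx_free_eq0 _ rN) => /eqP ->.
  exact: scons00.
move=> i; case: (unliftP ord0 i) => [j|] ->.
  have -> : row (lift ord0 j) (col_mx (z - z0) N : 'M[R]_(k.+1, m)) = row j N.
    apply/rowP => l; rewrite [RHS]mxE [LHS]mxE -(@col_mxEd _ 1 k _ (z - z0) N).
    by congr fun_of_matrix; exact: val_inj.
  exact: DN.
have -> : row ord0 (col_mx (z - z0) N : 'M[R]_(k.+1, m)) = z - z0.
  apply/rowP => l; rewrite [LHS]mxE -(@col_mxEu _ 1 k _ (z - z0) N ord0 l).
  by congr fun_of_matrix; exact: val_inj.
by rewrite addrC subrK.
Qed.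

Definition support_face (R : realType) n (P : set 'rV[R]_n) (u : 'rV[R]_n) (b : R) :
  set 'rV[R]_n := P `&` [set x | dotv u x = b].

Definition is_support (R : realType) n (P : set 'rV[R]_n) (u : 'rV[R]_n) (b : R) : Prop :=
  (forall x, P x -> dotv u x <= b) /\ exists2 x, P x & dotv u x = b.

Lemma unit_neq0 (R : realType) n (u : 'rV[R]_n) : dotv u u = 1 -> u != 0.
Proof. by move=> uu; rewrite -dotv_eq0 uu oner_eq0. Qed.

(** Either the slice lies in a hyperplane of the frame coordinates and is null, or it contains [m]
    independent directions from [z0], which [B] maps to the points that [facet] asks for. *)
Lemma support_facet_or_null (R : realType) m (u : 'rV[R]_m.+1) B
    (L : seq ('rV[R]_m.+1 * R)) M b :
  orthonormal_frame u B -> bounded_rV M (polyhedron L) -> is_support (polyhedron L) u b ->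
  facet (polyhedron L) (support_face (polyhedron L) u b) \/
  vol [set y | polyhedron L (b *: u + y *m B)] = 0.
Proof.
move=> fB PM [Pb [x0 Px0 x0b]]; have [uu BB Bu] := fB.
have [M' bD] := slice_nice (b *: u) fB PM.
set D := [set y | _] in bD *.
have xE x : dotv u x = b -> x = b *: u + (x *m B^T) *m B.
  by move=> xb; rewrite [LHS](frame_decomp x fB) mulmx_trE dotvC xb mul_scalar_mx.
pose z0 := x0 *m B^T.
have Dz0 : D z0 by rewrite /D/= -xE.
have [[c [c0 cD]]|nc] := pselect (exists c, c != 0 /\ forall z, D z -> dotv c (z - z0) = 0).
  right; apply: (vol_hyperplane c0 bD (d := dotv c z0)) => z Dz.
  by apply/eqP; rewrite -subr_eq0 -dotvBr cD.
left; have [|N [rN DN]] := @affinely_independent_points R m D z0 _ m (leqnn m).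
  move=> c c0; apply: contrapT => h; apply: nc; exists c; split => // z Dz.
  by apply/eqP; apply: contrapT => /negP cz; apply: h; exists z.
have uD z : dotv u (b *: u + z *m B) = b.
  by rewrite dotvDr dotvZr uu mulr1 (dotv_frame _ fB) addr0.
split.
  exists u, b; split; first exact: unit_neq0.
  by split=> //; split=> //; exists x0.
exists (b *: u + z0 *m B), (N *m B); split; [|split].
- by split; [exact: Dz0|exact: uD].
- by rewrite /row_free mxrankMfree// /row_free; apply/row_freeP; exists B^T.
- move=> i; rewrite row_mul -addrA -mulmxDl; split; [exact: DN|exact: uD].
Qed.

Lemma dotv_eq_orth (R : realType) n (P F : set 'rV[R]_n) s p v :
  orth s F -> F p -> F (p + v) -> dotv s v = 0.
Proof. by move=> sF Fp Fv; have := sF _ _ Fv Fp; rewrite addrC addKr. Qed.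

(** The rows of [N] and of [B] are two bases of the orthogonal complement of [u], and [N *m B^T] is
    the transition matrix. *)
Lemma facet_directions (R : realType) m (u : 'rV[R]_m.+1) B (N : 'M[R]_(m, m.+1)) :
  orthonormal_frame u B -> row_free N -> N *m u^T = 0 ->
  (N *m B^T) \in unitmx /\ N = (N *m B^T) *m B.
Proof.
move=> fB rN Nu; have E : N = (N *m B^T) *m B.
  by rewrite {1}(frame_decomp N fB) Nu mul0mx add0r.
split=> //; rewrite -row_free_unit; apply: inj_row_free => v vN.
apply/eqP; rewrite -(mulmx_free_eq0 v rN); apply/eqP.
by rewrite E mulmxA vN mul0mx.
Qed.

Lemma rows_orth (R : realType) k n (N : 'M[R]_(k, n)) (a : 'rV[R]_n) :
  (forall i, dotv a (row i N) = 0) -> N *m a^T = 0.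
Proof.
move=> h; apply/row_matrixP => i; rewrite row_mul row0 mulmx_trE dotvC h.
by rewrite raddf0.
Qed.

(** The [m] independent directions in [F] are orthogonal both to [u] and to the normal [c] of the
    face, so [c] is a nonzero multiple [k] of [u]; the sign of [k] selects the maximal or the
    minimal face. *)
Lemma facet_orth_support (R : realType) m (P : set 'rV[R]_m.+1) (u : 'rV[R]_m.+1) a b F :
  dotv u u = 1 -> is_support P u b -> is_support P (- u) a ->
  facet P F -> orth u F ->
  F = support_face P u b \/ F = support_face P (- u) a.
Proof.
move=> uu [Pb [xb Pxb xbE]] [Pa [xa Pxa xaE]] [[c [d [c0 [Pc [FE _]]]]] [p [N [Fp [rN FN]]]]] uF.
have [B fB] := orthonormal_frame_exists uu; have [_ BB Bu] := fB.
have Nu : N *m u^T = 0 by apply: rows_orth => i; apply: (dotv_eq_orth P uF Fp).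
have cF : orth c F by move=> x y; rewrite FE => -[_ /= cx] [_ /= cy]; rewrite dotvBr cx cy subrr.
have Nc : N *m c^T = 0 by apply: rows_orth => i; apply: (dotv_eq_orth P cF Fp).
have [uN NE] := facet_directions fB rN Nu.
move: (N *m B^T) uN NE => Y uY NE.
have Bc : B *m c^T = 0.
  move: Nc; rewrite NE -mulmxA => /(congr1 (mulmx (invmx Y))).
  by rewrite mulKmx// mulmx0.
have cB : c *m B^T = 0 by rewrite -[LHS]trmxK trmx_mul trmxK Bc trmx0.
have cE : c = dotv c u *: u.
  by rewrite {1}(frame_decomp c fB) cB mul0mx addr0 mulmx_trE mul_scalar_mx.
move: (dotv c u) cE => k cE; move: Fp; rewrite FE cE => -[Pp /= pd].
rewrite dotvZl in pd.
have Pc' x : P x -> k * dotv u x <= d by move=> /Pc; rewrite cE dotvZl.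
have [k0|k0|k0] := ltgtP k 0.
- right; have da : d = - k * a.
    apply/eqP; rewrite eq_le; apply/andP; split.
      by rewrite -pd -mulrNN ler_pM2l ?oppr_gt0// -dotvN Pa.
    by rewrite -xaE dotvN mulrNN Pc'.
  have nk0 : - k != 0 by rewrite oppr_eq0 lt_eqF.
  rewrite /support_face; congr (_ `&` _); apply/funext => x; apply/propext => /=.
  by rewrite dotvZl da dotvN -mulrNN; split => [/(mulfI nk0)|->].
- left; have da : d = k * b.
    apply/eqP; rewrite eq_le; apply/andP; split.
      by rewrite -pd ler_pM2l// Pb.
    by rewrite -xbE Pc'.
  have nk0 : k != 0 by rewrite gt_eqF.
  rewrite /support_face; congr (_ `&` _); apply/funext => x; apply/propext => /=.
  by rewrite dotvZl da; split => [/(mulfI nk0)|->].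
- by move: c0; rewrite cE k0 scale0r eqxx.
Qed.

(** [facet_area] picks its point and basis by choice, so both must be shown to exist and the chosen
    basis to be orthogonal to [u]; [slice_vol_eq] then makes the choice immaterial. *)
Lemma facet_area_slice (R : realType) m (L : seq ('rV[R]_m.+1 * R)) M (u : 'rV[R]_m.+1) B b :
  let F := support_face (polyhedron L) u b in
  orthonormal_frame u B -> bounded_rV M (polyhedron L) -> facet (polyhedron L) F ->
  F (ptF F) /\ facet_area F = vol [set y | polyhedron L (b *: u + y *m B)].
Proof.
move=> F fB PM [[_ [_ [_ [_ [_ F0]]]]] [p0 [N [Fp0 [rN FN]]]]].
have [uu BB Bu] := fB.
have Fp : F (ptF F) by exact: (xgetPex 0 F0).
split=> //; rewrite /facet_area; set p := ptF F in Fp *.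
set S := (X in xget _ X); set B' := xget _ S.
have [BB' FB'] : S B'.
  apply: (xgetPex 0); exists B; split => // x Fx; exists ((x - p) *m B^T).
  rewrite -(frame_face_difference fB); first by rewrite addrC subrK.
  by rewrite dotvBr Fx.2 Fp.2 subrr.
have uF : orth u F by move=> x y [_ /= ux] [_ /= uy]; rewrite dotvBr ux uy subrr.
have Nu : N *m u^T = 0.
  by apply: rows_orth => i; apply: (dotv_eq_orth (polyhedron L) uF Fp0).
(* The rows of [B'] span the [m] independent directions [N] of the facet: N = Y B' with [Y]
   invertible, and [N] is orthogonal to [u]. *)
have B'u : B' *m u^T = 0.
  have [y0 y0E] := FB' _ Fp0.
  have [Y YE] : exists Y, N = Y *m B'.
    have /choice[y yE] := fun i => FB' _ (FN i).
    exists (\matrix_i (y i - y0)); apply/row_matrixP => i.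
    by rewrite row_mul rowK mulmxBl -[LHS](addKr p0) yE {1}y0E opprD addrACA addNr add0r addrC.
  have uY : Y \in unitmx.
    rewrite -row_free_unit; apply: inj_row_free => v vY.
    by apply/eqP; rewrite -(mulmx_free_eq0 v rN) YE mulmxA vY mul0mx.
  move: Nu; rewrite YE -mulmxA => /(congr1 (mulmx (invmx Y))).
  by rewrite mulKmx// mulmx0.
have fB' : orthonormal_frame u B' by split.
have -> : [set y | F (p + y *m B')] = [set y | polyhedron L (p + y *m B')].
  apply/seteqP; split => y /=; first by case.
  by move=> Py; split => //=; rewrite dotvDr (dotv_frame _ fB') addr0 Fp.2.
apply: (slice_vol_eq fB' fB PM).
by rewrite dotvZr uu mulr1 Fp.2.
Qed.

(** * The leading coefficient *)

Lemma hull_vertex (R : realType) n k (V : 'I_k -> 'rV[R]_n) j :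
  exists w : 'I_k -> R, (forall j, 0 <= w j) /\
    \sum_(j < k) w j = 1 /\ V j = \sum_(j < k) w j *: V j.
Proof.
exists (fun i => (i == j)%:R); split; first by move=> i; case: eqP.
split; rewrite (bigD1 j)//= eqxx big1 ?addr0 ?scale1r//.
  by move=> i /negbTE ->.
by move=> i /negbTE ->; rewrite scale0r.
Qed.

Lemma hull_bounded (R : realType) n k (V : 'I_k -> 'rV[R]_n) :
  bounded_rV (\sum_j \sum_i `|V j ord0 i|)
    [set x | exists w : 'I_k -> R, (forall j, 0 <= w j) /\
       \sum_(j < k) w j = 1 /\ x = \sum_(j < k) w j *: V j].
Proof.
move=> x [w [w0 [w1 ->]]] i; rewrite summxE (le_trans (ler_norm_sum _ _ _))//.
apply: ler_sum => j _; rewrite mxE normrM ger0_norm//.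
have wj : w j <= 1 by rewrite -w1 (bigD1 j)//= lerDl sumr_ge0.
rewrite (@le_trans _ _ `|V j ord0 i|)// ?ler_piMl//.
by rewrite (bigD1 i)//= lerDl sumr_ge0.
Qed.

Lemma hull_support (R : realType) n k (V : 'I_k -> 'rV[R]_n) (u x0 : 'rV[R]_n) :
  let P := [set x | exists w : 'I_k -> R, (forall j, 0 <= w j) /\
       \sum_(j < k) w j = 1 /\ x = \sum_(j < k) w j *: V j] in
  P x0 -> exists b, is_support P u b.
Proof.
move=> P [w0 [_ [w01 _]]].
have j0 : 'I_k.
  case: k V w0 w01 @P => [V w0|k _ _ _ _]; last exact: ord0.
  by rewrite big_ord0 => /eqP; rewrite eq_sym oner_eq0.
have [j _ jmax] := @arg_maxP _ _ _ j0 xpredT (fun j => dotv u (V j)) isT.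
exists (dotv u (V j)); split; last by exists (V j) => //; exact: hull_vertex.
move=> x [w [wge [w1 ->]]].
have -> : dotv u (\sum_j w j *: V j) = \sum_j w j * dotv u (V j).
  rewrite (big_morph (dotv u) (id1 := 0) (op1 := +%R)); last 2 first.
  - by move=> y z; rewrite dotvDr.
  - by rewrite dotvC dotv0l.
  by apply: eq_bigr => i _; rewrite dotvZr.
rewrite -[leRHS]mul1r -w1 mulr_suml ler_sum// => i _.
by rewrite ler_wpM2l//; exact: jmax.
Qed.

Lemma sgnP_support (R : realType) n (P : set 'rV[R]_n) (u : 'rV[R]_n) (b t : R) :
  dotv u u = 1 -> is_support P u b -> 0 < t -> sgnP P (support_face P u b) (t *: u) = 1.
Proof.
move=> uu [Pb _] t0; rewrite /sgnP asboolT//; exists u, t; split => //; split.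
  by rewrite /normv uu sqrtr1.
split; first by move=> x y [_ /= ux] [_ /= uy]; rewrite dotvBr ux uy subrr.
by move=> x y [_ /= ux] /Pb; rewrite ux.
Qed.

(** If [t *: u] were a positive multiple of an outward normal, comparing a point of this face with a
    maximizer of [u] would give [b <= - a]. *)
Lemma sgnP_opposite (R : realType) n (P : set 'rV[R]_n) (u : 'rV[R]_n) (a b t : R) :
  is_support P u b -> is_support P (- u) a -> - a < b -> 0 < t ->
  sgnP P (support_face P (- u) a) (t *: u) = -1.
Proof.
move=> [_ [y Py yb]] [_ [x Px xa]] ab t0; rewrite /sgnP asboolF//.
move=> [nu [t' [[_ [_ hnu]] [t'0 tE]]]].
have := hnu x y (conj Px xa) Py; rewrite -(ler_pM2l t'0) -!dotvZl -tE !dotvZl ler_pM2l//.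
by rewrite yb -[dotv u x]opprK -dotvN xa leNgt ab.
Qed.

(** The ball inside [P] contains two points at different heights along [u]: its centre and
    [c + (r / 2) *: u]. *)
Lemma support_gap (R : realType) n (P : set 'rV[R]_n) (u : 'rV[R]_n) (a b : R) c r :
  dotv u u = 1 -> 0 < r -> (forall x, normv (x - c) < r -> P x) ->
  is_support P u b -> is_support P (- u) a -> - a < b.
Proof.
move=> uu r0 Pc [Pb _] [Pa _].
have Pcc : P c by apply: Pc; rewrite subrr /normv dotv0l sqrtr0.
have : P (c + (r / 2) *: u).
  apply: Pc; rewrite addrC addKr /normv dotvZl dotvZr uu mulr1 -expr2 sqrtr_sqr.
  by rewrite gtr0_norm ?divr_gt0//; lra.
move=> /Pb; rewrite dotvDr dotvZr uu mulr1; have := Pa _ Pcc; rewrite dotvN.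
by have : 0 < r / 2 by [rewrite divr_gt0]; lra.
Qed.

Lemma fsum_facet1 (R : realType) (V : zmodType) n (P F : set 'rV[R]_n)
    (g : set 'rV[R]_n -> V) (v : V) :
  (facet P F -> g F = v) -> (~ facet P F -> v = 0) ->
  \sum_(G \in [set G | G = F /\ facet P F]) g G = v.
Proof.
move=> gF vF; have [fF|nF] := pselect (facet P F).
  rewrite (_ : [set _ | _] = [set F]) ?fsbig_set1 ?gF//.
  by apply/seteqP; split => G /=; [case|].
rewrite (_ : [set _ | _] = set0) ?fsbig_set0 ?vF//.
by apply/seteqP; split => G // -[].
Qed.

(** Only the two support faces can occur in the sum. One that is not a facet is missing from it, but
    then its slice is null, so the right-hand side is the same in all cases. *)
Lemma facet_sum (R : realType) m (L : seq ('rV[R]_m.+1 * R)) M (u : 'rV[R]_m.+1) B (a b t l : R) :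
  let P := polyhedron L in
  orthonormal_frame u B -> bounded_rV M P -> is_support P u b -> is_support P (- u) (- a) ->
  a < b -> 0 < t ->
  \sum_(F \in [set F | facet P F /\ orth (t *: u) F])
     (real_complex R (sgnP P F (t *: u) * facet_area F) *
      expi (- (l * dotv (t *: u) (ptF F)))) =
  real_complex R (vol [set y | P (b *: u + y *m B)]) * expi (- (l * t * b)) -
  real_complex R (vol [set y | P (a *: u + y *m B)]) * expi (- (l * t * a)).
Proof.
move=> P fB PM sb sa ab t0; have [uu BB Bu] := fB.
have fBN : orthonormal_frame (- u) B.
  by split => //; [rewrite dotvN dotvC dotvN opprK|rewrite linearN/= mulmxN Bu oppr0].
pose Ft := support_face P u b; pose Fb := support_face P (- u) (- a).
have orth_t F : orth u F -> orth (t *: u) F.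
  by move=> uF x y Fx Fy; rewrite dotvZl uF// mulr0.
have SE : [set F | facet P F /\ orth (t *: u) F] =
    [set F | F = Ft /\ facet P Ft] `|` [set F | F = Fb /\ facet P Fb].
  apply/seteqP; split => F /=.
    move=> [fF tF]; have uF : orth u F.
      move=> x y Fx Fy; have := tF x y Fx Fy; rewrite dotvZl => /eqP.
      by rewrite mulf_eq0 gt_eqF//= => /eqP.
    have [FE|FE] := facet_orth_support uu sb sa fF uF; [left|right];
      by split => //; rewrite /Ft /Fb -FE.
  move=> [[-> fF]|[-> fF]]; split => //; apply: orth_t => x y [_ /= hx] [_ /= hy].
    by rewrite dotvBr hx hy subrr.
  by rewrite -[u]opprK dotvN dotvBr hx hy subrr oppr0.
(* Distinctness keeps the two index sets disjoint, so that the sum splits. *)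
have neq : Ft <> Fb.
  have [_ [x Px xb]] := sb => E; have : Fb x by rewrite -E.
  move=> [_ /=]; rewrite dotvN xb => /oppr_inj ba; by move: ab; rewrite ba ltxx.
have fin (F : set 'rV[R]_m.+1) (Q : Prop) : finite_set [set G | G = F /\ Q].
  by apply: (sub_finite_set (B := [set F])) => // G /= [].
rewrite SE fsbigU//; last by move=> F [[-> _] [/neq]].
congr (_ + _).
  apply: fsum_facet1 => [fF|nF].
    have [Fp ->] := facet_area_slice fB PM fF.
    by rewrite (sgnP_support uu sb t0) mul1r dotvZl Fp.2 mulrA.
  have [//|->] := support_facet_or_null fB PM sb.
  by rewrite raddf0 mul0r.
have uN z : - a *: - u + z *m B = a *: u + z *m B by rewrite scalerN scaleNr opprK.
apply: fsum_facet1 => [fF|nF].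
  have [Fp ->] := facet_area_slice fBN PM fF.
  rewrite (sgnP_opposite sb sa)// ?opprK// mulN1r raddfN mulNr; congr (- (_ * _)).
    by congr (real_complex R (vol _)); apply/funext => y; rewrite /= uN.
  congr expi; congr (- _); rewrite dotvZl -mulrA; congr (_ * (_ * _)).
  by apply/oppr_inj; rewrite -dotvN; exact: Fp.2.
have [//|h] := support_facet_or_null fBN PM sa.
rewrite (_ : vol _ = 0) ?raddf0 ?mul0r ?oppr0//.
by rewrite -h; congr vol; apply/funext => y; rewrite /= uN.
Qed.

Lemma normc_le (R : realType) (x y : R) : ComplexField.Normc.normc (Complex x y) <= `|x| + `|y|.
Proof.
rewrite /= -[leRHS]ger0_norm ?addr_ge0// -sqrtr_sqr ler_wsqrtr//.
by rewrite sqrrD !real_normK ?num_real// lerD2r lerDl mulrn_wge0// mulr_ge0.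
Qed.

(** Rotating by the frame matrix turns [dotv u] into the first coordinate and keeps the integral; a
    row [c] of the polyhedron becomes [c *m Q^T]. *)
Lemma frame_asymptotics (R : realType) m (L : seq ('rV[R]_m.+1 * R)) M (u : 'rV[R]_m.+1) B a b th :
  let P := polyhedron L in
  orthonormal_frame u B -> bounded_rV M P -> is_support P u b -> is_support P (- u) (- a) ->
  exists2 C : R, 0 <= C & forall w : R, 0 < w ->
    `|iint (fun x => \1_P x * cos (- (w * dotv u x) + th)) -
      w^-1 * (vol [set y | P (b *: u + y *m B)] * sin (w * b - th) -
              vol [set y | P (a *: u + y *m B)] * sin (w * a - th))| <= C / w ^+ 2.
Proof.
move=> P fB PM [Pb [xb Pxb xbE]] [Pa [xa Pxa xaE]].
have QQ := frame_mx_orthogonal fB; set Q := frame_mx u B in QQ.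
have QTQ : Q^T *m Q = 1%:M by exact: mulmx1C.
pose L' := [seq (c.1 *m Q^T, c.2) | c : 'rV[R]_m.+1 * R <- L].
have PE z : polyhedron L' z <-> P (z *m Q).
  split=> h c cL.
    by rewrite dotv_mul; apply: (h (c.1 *m Q^T, c.2)); apply/mapP; exists c.
  by move/mapP: cL => [d dL ->] /=; rewrite -dotv_mul; exact: h.
have uE z : dotv u (z *m Q) = z ord0 ord0.
  have [uu _ _] := fB; rewrite -[z]scons_stail scons_frame dotvDr dotvZr uu mulr1.
  by rewrite (dotv_frame _ fB) addr0 scons_head.
have M0 : 0 <= M by apply: le_trans (PM _ Pxa ord0).
have [M' _ M'P] := mulmx_bounded Q^T M0.
have PM' x : polyhedron L' x -> forall i, `|x ord0 i| <= M'.
  by move=> /PE/PM/M'P; rewrite -mulmxA QQ mulmx1.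
have Pab x : polyhedron L' x -> a <= x ord0 ord0 <= b.
  move=> /PE Px; rewrite -uE Pb// andbT -lerN2 -dotvN; exact: Pa.
have Lxa : exists2 x, polyhedron L' x & x ord0 ord0 = a.
  exists (xa *m Q^T); first by apply/PE; rewrite -mulmxA QTQ mulmx1.
  by rewrite -uE -mulmxA QTQ mulmx1; apply/oppr_inj; rewrite -dotvN.
have Lxb : exists2 x, polyhedron L' x & x ord0 ord0 = b.
  exists (xb *m Q^T); first by apply/PE; rewrite -mulmxA QTQ mulmx1.
  by rewrite -uE -mulmxA QTQ mulmx1.
have [C C0 HC] := polyhedron_asymptotics th PM' Pab Lxa Lxb.
have SE t : [set y | polyhedron L' (scons t y)] = [set y | P (t *: u + y *m B)].
  by apply/funext => y; apply/propext => /=; rewrite PE scons_frame.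
exists C => // w w0; have := HC w w0; rewrite !SE; congr (`|_ - _| <= _).
have nf : nice (fun x => \1_P x * cos (- (w * dotv u x) + th)).
  apply: (nice_indic_mul (C := 1) (borel_polyhedron L) PM).
    have := borel_cos_comp (- w) th (borel_dotv u); congr borel; apply/funext => x.
    by rewrite mulNr.
  by move=> x; exact: cos_norm_le1.
rewrite -(iint_orthogonal QQ nf); apply: eq_iint => z; rewrite uE !indicE.
by congr ((nat_of_bool _)%:R * _); apply/idP/idP; rewrite !inE => /PE.
Qed.

(* phi_{P,s}(lambda) = lead(lambda) * lambda + O(lambda^2) as lambda -> 0+ *)
Theorem theorem1 (R : realType) (n : nat) (P : set 'rV[R]_n) (s : 'rV[R]_n) :
  convex_polytope P -> s != 0 ->
  exists (C delta : R), 0 < C /\ 0 < delta /\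
    forall l : R, 0 < l -> l < delta ->
      ComplexField.Normc.normc (phiPs P s l - lead_coef_phi P s l * real_complex R l) <= C * l ^+ 2.
Proof.
case: n P s => [P s _|m P s]; first by rewrite thinmx0 eqxx.
move=> [[k [V PV]] [c [r [r0 Pc]]]] s0.
have Pcc : P c by apply: Pc; rewrite subrr /normv dotv0l sqrtr0.
pose t := normv s.
have t0 : 0 < t by rewrite /t /normv sqrtr_gt0 lt0r dotv_eq0 s0 dotv_ge0.
pose u := t^-1 *: s.
have uu : dotv u u = 1.
  by rewrite dotvZl dotvZr -sqr_normv -/t; field; rewrite gt_eqF.
have sE : s = t *: u by rewrite scalerA divff ?scale1r// gt_eqF.
have [B fB] := orthonormal_frame_exists uu.
have [L PL] := hull_polyhedron V.
have PM := hull_bounded (V := V).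
have := Pcc; rewrite {1}PV => Pc'.
have [b sb] := hull_support u Pc'; have [a sa] := hull_support (- u) Pc'.
rewrite -PV in PM sb sa; rewrite -PV in PL.
have ab := support_gap uu r0 Pc sb sa.
rewrite PL in PM sb sa *.
(* Here [a] is the maximum of [- u]; the lemmas are applied to the minimum of [u], which is
   [- a]. *)
rewrite -[a]opprK in sa.
(* The shift 0 treats the real part, and cos (x - pi / 2) = sin x the imaginary part. *)
have [C1 C10 HC1] := frame_asymptotics 0 fB PM sb sa.
have [C2 C20 HC2] := frame_asymptotics (- (pi / 2)) fB PM sb sa.
(* With w = t / l the errors are C l^2 / t^2; the added 1 makes the constant positive. The estimate
   holds for every [l > 0], so [delta] is an arbitrary choice. *)
exists ((C1 + C2) / t ^+ 2 + 1), 1; split.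
  by rewrite ltr_wpDl// divr_ge0 ?addr_ge0// sqr_ge0.
split => // l l0 _.
pose w := l^-1 * t; have w0 : 0 < w by rewrite mulr_gt0// invr_gt0.
have := HC1 w w0; have := HC2 w w0.
set vb := vol _; set va := vol _ => H2 H1.
have FS := facet_sum l^-1 fB PM sb sa ab t0; rewrite -sE -/vb -/va in FS.
rewrite /lead_coef_phi FS /phiPs -/t /expi.
set I1 := iint _; set I2 := iint _.
have E1 : I1 = iint (fun x => \1_(polyhedron L) x * cos (- (w * dotv u x) + 0)).
  by apply: eq_iint => x; rewrite addr0 {1}sE dotvZl mulrA.
have E2 : I2 = iint (fun x => \1_(polyhedron L) x * cos (- (w * dotv u x) + - (pi / 2))).
  by apply: eq_iint => x; rewrite cosBpihalf {1}sE dotvZl mulrA.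
rewrite -E1 in H1; rewrite -E2 in H2.
have wl : w^-1 = t^-1 * l by rewrite /w invfM invrK mulrC.
apply: (@le_trans _ _ (C1 / w ^+ 2 + C2 / w ^+ 2)); last first.
  rewrite -mulrDl -exprVn wl exprMn exprVn mulrA ler_wpM2r ?sqr_ge0//.
  by rewrite lerDl.
(* Real and imaginary parts are matched through i e^(-i x) = sin x + i cos x, where cos x = sin (x +
   pi / 2). *)
have -> : Complex I1 I2 - Complex 0 1 * real_complex R t^-1 *
    (real_complex R vb * Complex (cos (- (l^-1 * t * b))) (sin (- (l^-1 * t * b))) -
     real_complex R va * Complex (cos (- (l^-1 * t * - a))) (sin (- (l^-1 * t * - a)))) *
    real_complex R l =
  Complex (I1 - w^-1 * (vb * sin (w * b - 0) - va * sin (w * - a - 0)))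
          (I2 - w^-1 * (vb * sin (w * b - - (pi / 2)) - va * sin (w * - a - - (pi / 2)))).
  rewrite wl -/w !cosN !sinN !opprK !subr0 !sinDpihalf /real_complex_def.
  simpc; congr Complex; ring.
apply: le_trans (normc_le _ _) _; exact: lerD.
Qed.
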